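(* Let $q\ge 3$ be an integer and let $Y$ be a connected regular graph on $q-1$ vertices. Then the following hold (graphs in the lists may coincide up to isomorphism in the smallest cases, and all identifications of $Y$ are up to isomorphism). (a) $Y[\overline{K_q}]$ is Ramanujan if and only if $Y$ is one of: $K_{q-1}$; $K_{r,r}$ with $q-1=2r$; $K_{r,r}\setminus M$ with $q-1=2r$ and $q\ge 7$, where $M$ is a perfect matching of $K_{r,r}$. (b) $Y[K_q]$ is Ramanujan if and only if $Y$ is one of: $K_{q-1}$; the cocktail-party graph $K_{2r}\setminus M$ with $q-1=2r$ and $q\ge 5$, where $M$ is a perfect matching of $K_{2r}$.
   Context: Graphs are finite, simple and undirected. A connected $d$-regular graph is called Ramanujan if every adjacency eigenvalue $\lambda$ with $|\lambda|\ne d$ satisfies $|\lambda|\le 2\sqrt{d-1}$ (so for a bipartite graph both $d$ and $-d$ are regarded as trivial eigenvalues). For graphs $Y,Z$, the lexicographic product $Y[Z]$ has vertex set $V(Y)\times V(Z)$, with $(y,z)$ adjacent to $(y',z')$ iff $y$ is adjacent to $y'$ in $Y$, or $y=y'$ and $z$ is adjacent to $z'$ in $Z$. $K_n$ is the complete graph on $n$ vertices, $\overline{K_n}$ the edgeless graph on $n$ vertices, $K_{r,r}$ the complete bipartite graph with parts of size $r$, and $\Gamma\setminus M$ denotes $\Gamma$ with the edges of $M$ deleted. *)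

(* Defs.v *)
From mathcomp Require Import all_boot all_order all_algebra.
Set Implicit Arguments.
Unset Strict Implicit.
Unset Printing Implicit Defensive.
Import GRing.Theory Num.Theory.
Local Open Scope ring_scope.

Record sgraph := SGraph {
  vertex :> finType;
  adj : rel vertex;
  adj_sym : symmetric adj;
  adj_irr : irreflexive adj }.

Definition graph_iso (G H : sgraph) : Prop :=
  exists2 f : G -> H, bijective f & forall x y, adj (f x) (f y) = adj x y.

Definition connected (G : sgraph) : Prop :=
  forall x y : G, connect (@adj G) x y.

Definition regular_of (d : nat) (G : sgraph) : Prop :=
  forall x : G, #|[set y | adj x y]| = d.

Definition regular (G : sgraph) : Prop := exists d, regular_of d G.

Definition edges (G : sgraph) : {set {set G}} :=
  [set e | [exists x, exists y, adj x y && (e == [set x; y])]].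

Definition perfect_matching (G : sgraph) (M : {set {set G}}) : Prop :=
  M \subset edges G /\ partition M [set: G].

Definition adj_mx (F : fieldType) (G : sgraph) : 'M[F]_#|G| :=
  \matrix_(i, j) (adj (enum_val i) (enum_val j))%:R.

(* The eigenvalues are taken in an algebraically closed field with conjugation
   (the complex numbers, for instance), so that none is missed; the matrix being
   real symmetric, they are in fact real. *)
Definition ramanujan (C : numClosedFieldType) (G : sgraph) : Prop :=
  connected G /\ exists2 d : nat, regular_of d G &
    forall lam : C, eigenvalue (adj_mx C G) lam ->
      `|lam| != d%:R -> `|lam| <= 2 * sqrtC (d%:R - 1).

Section Complete.
Variable n : nat.
Definition complete_adj : rel 'I_n := fun x y => x != y.
Lemma complete_sym : symmetric complete_adj.
Proof. by move=> x y; rewrite /complete_adj eq_sym. Qed.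
Lemma complete_irr : irreflexive complete_adj.
Proof. by move=> x; rewrite /complete_adj eqxx. Qed.
Definition complete_graph := SGraph complete_sym complete_irr.

Definition edgeless_adj : rel 'I_n := fun _ _ => false.
Lemma edgeless_sym : symmetric edgeless_adj. Proof. by []. Qed.
Lemma edgeless_irr : irreflexive edgeless_adj. Proof. by []. Qed.
Definition edgeless_graph := SGraph edgeless_sym edgeless_irr.
End Complete.

Section CompleteBipartite.
Variables m n : nat.
Definition bipartite_adj : rel ('I_m + 'I_n)%type := fun u v =>
  match u, v with
  | inl _, inr _ | inr _, inl _ => true
  | _, _ => false
  end.
Lemma bipartite_sym : symmetric bipartite_adj. Proof. by move=> [] ? [] ?. Qed.
Lemma bipartite_irr : irreflexive bipartite_adj. Proof. by case. Qed.
Definition complete_bipartite := SGraph bipartite_sym bipartite_irr.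
End CompleteBipartite.

Section DeleteEdges.
Variables (G : sgraph) (M : {set {set G}}).
Definition delete_adj : rel G := fun x y => adj x y && ([set x; y] \notin M).
Lemma delete_sym : symmetric delete_adj.
Proof. by move=> x y; rewrite /delete_adj adj_sym setUC. Qed.
Lemma delete_irr : irreflexive delete_adj.
Proof. by move=> x; rewrite /delete_adj adj_irr. Qed.
Definition delete_edges := SGraph delete_sym delete_irr.
End DeleteEdges.

Section LexProduct.
Variables Y Z : sgraph.
Definition lex_adj : rel (Y * Z)%type := fun u v =>
  adj u.1 v.1 || ((u.1 == v.1) && adj u.2 v.2).
Lemma lex_sym : symmetric lex_adj.
Proof.
by move=> u v; rewrite /lex_adj adj_sym eq_sym [adj u.2 v.2]adj_sym.
Qed.
Lemma lex_irr : irreflexive lex_adj.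
Proof. by move=> u; rewrite /lex_adj !adj_irr andbF. Qed.
Definition lex_product := SGraph lex_sym lex_irr.
End LexProduct.

(* Main.v *)
(* Let H be the complement of Y, regular of degree j.  A Ramanujan graph G of
   degree d satisfies |A f|^2 <= 4 (d - 1) |f|^2 for all functions f orthogonal
   to the eigenfunctions of the eigenvalues d and -d.  For functions on the
   lexicographic product that come from a function v of sum zero on Y, and
   n = q - 1 vertices, this bounds the norm of q H v + s v, with s = q for the
   edgeless fibre (when Y is not bipartite) and s = 1 for the complete one.
   The vector v = n e_x - 1 forces j <= 2, respectively j <= 3, and a few more
   test vectors leave j = 0, respectively j <= 1:
   - v = n 1_S - |S|, for S an edge (edgeless fibre), or a triangle of a cubic
     H (complete fibre);
   - (I - H)(e_x - e_y), for an edge xy of a triangle-free cubic H;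
   - for a 2-regular H, a union of cycles, v = n 1_S - |S| with S a component
     shows that H is one cycle, and a vector alternating in sign along this
     cycle (with a 0 entry if n is odd) concludes.
   If Y is bipartite with parts of size r and the fibre is edgeless, the vector
   r e_x - 1_P, with P the part of x, shows that Y has degree r or r - 1.
   Conversely the spectra of the listed graphs are read off the equations
   satisfied by the fibre sums of an eigenfunction of the product. *)
Require Import Defs.
From mathcomp Require Import all_boot all_order all_algebra.
From mathcomp Require Import spectral sesquilinear zify ring lra.
Set Implicit Arguments.
Unset Strict Implicit.
Unset Printing Implicit Defensive.
Import Order.TTheory GRing.Theory Num.Theory.
Local Open Scope ring_scope.
Local Open Scope sesquilinear_scope.

(** * Spectral bounds *)

(** Spectral theorem: in an orthonormal eigenbasis the squared norms become weighted sums of squared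
    coordinates. Each coordinate of [v] either vanishes by orthogonality or belongs to an eigenvalue
    with square at most [D]. *)
Lemma hermitian_norm_bound (C : numClosedFieldType) n (A : 'M[C]_n) (D : C)
    (v : 'rV[C]_n) :
  A \is hermsymmx ->
  (forall (a : C) (w : 'rV[C]_n), a \is Num.real -> w != 0 -> w *m A = a *: w ->
     a ^+ 2 <= D \/ \sum_i v 0 i * (w 0 i)^* = 0) ->
  \sum_i `|(v *m A) 0 i| ^+ 2 <= D * \sum_i `|v 0 i| ^+ 2.
Proof.
move=> hA hD.
have /orthomx_spectralP dA := hermitian_normalmx hA.
set U := spectralmx A in dA; set d := spectral_diag A in dA.
have uU : U \is unitarymx by apply: spectral_unitarymx.
have Uu := spectral_unit A.
have iU : invmx U = U ^t* by apply: invmx_unitary.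
have dr i : d 0 i \is Num.real.
  by have /mxOverP := hermitian_spectral_diag_real hA; apply.
have nE (u : 'rV[C]_n) : \sum_i `|u 0 i| ^+ 2 = (u *m u ^t*) 0 0.
  by rewrite mxE; apply: eq_bigr => i _; rewrite !mxE -normCK.
have rowE i : row i U *m A = d 0 i *: row i U.
  rewrite {1}dA !mulmxA -row_mul mulmxV // row1.
  by rewrite -rowE row_diag_mx -scalemxAl -rowE.
(* The coordinates of [v] in the eigenbasis formed by the rows of [U]. *)
pose c := v *m U ^t*.
have cE i : c 0 i = \sum_j v 0 j * ((row i U) 0 j)^*.
  by rewrite mxE; apply: eq_bigr => j _; rewrite !mxE.
have vE : v = c *m U by rewrite /c -iU mulmxKV.
have nU (u : 'rV[C]_n) : \sum_i `|(u *m U) 0 i| ^+ 2 = \sum_i `|u 0 i| ^+ 2.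
  rewrite !nE trmx_mul map_mxM mulmxA -(mulmxA u).
  by move/unitarymxP: uU => ->; rewrite mulmx1.
have -> : v *m A = (c *m diag_mx d) *m U.
  by rewrite dA /c -iU !mulmxA.
rewrite nU [in leRHS]vE nU mulr_sumr; apply: ler_sum => i _.
rewrite mul_mx_diag mxE normrM exprMn mulrC.
have wN0 : row i U != 0.
  apply/eqP => r0; move/row_unitarymxP: uU => /(_ i i).
  by rewrite r0 linear0l eqxx => /eqP; rewrite eq_sym oner_eq0.
case: (hD _ _ (dr i) wN0 (rowE i)) => [le|]; last first.
  by rewrite -cE => ->; rewrite normr0 expr0n !mulr0.
by rewrite ler_wpM2r ?exprn_ge0 // real_normK.
Qed.

(** * Adjacency eigenvalues and the Ramanujan inequality for functions on vertices *)

Section Spectrum.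
Variable C : numClosedFieldType.

Lemma adj_mxE (G : sgraph) (w : 'rV[C]_#|G|) (x : G) :
  (w *m adj_mx C G) 0 (enum_rank x) = \sum_(y | adj x y) w 0 (enum_rank y).
Proof.
rewrite mxE (reindex (@enum_rank G)) /=; last first.
  by apply: onW_bij; apply: enum_rank_bij.
rewrite [RHS]big_mkcond /=; apply: eq_bigr => y _.
by rewrite !mxE !enum_rankK adj_sym; case: adj; rewrite ?mulr1 ?mulr0.
Qed.

(** Replaces row vectors indexed by ordinals by functions on the vertices; symmetry of adjacency
    makes the left action a sum over neighbours. *)
Lemma eigenvalue_adjP (G : sgraph) (a : C) :
  eigenvalue (adj_mx C G) a <->
  exists2 w : G -> C, (exists x, w x != 0) &
    forall x, \sum_(y | adj x y) w y = a * w x.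
Proof.
split=> [/eigenvalueP[v vA /rV0Pn[i vi]]|[w [x wx] wA]].
  exists (fun x => v 0 (enum_rank x)) => [|x].
    by exists (enum_val i); rewrite enum_valK.
  by rewrite -adj_mxE vA mxE.
apply/eigenvalueP; exists (\row_i w (enum_val i)).
  apply/rowP => i; rewrite -(enum_valK i) adj_mxE !mxE enum_rankK -wA.
  by apply: eq_bigr => y _; rewrite mxE enum_rankK.
by apply/rV0Pn; exists (enum_rank x); rewrite mxE enum_rankK.
Qed.

Lemma adj_mx_herm (G : sgraph) : adj_mx C G \is hermsymmx.
Proof.
apply: realsym_hermsym.
  apply/is_hermitianmxP; apply/matrixP => i j.
  by rewrite expr0 scale1r map_mx_id // !mxE adj_sym.
by apply/mxOverP => i j; rewrite mxE realn.
Qed.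

Lemma sum_adj_const (R : nzRingType) (G : sgraph) (d : nat) (x : G) (c : R) :
  regular_of d G -> \sum_(y | adj x y) c = d%:R * c.
Proof.
move=> /(_ x) dG; rewrite sumr_const -dG mulr_natl; congr (_ *+ _).
by apply: eq_card => y; rewrite inE.
Qed.

Lemma sum_adj_exchange (R : nzRingType) (G : sgraph) (F : G -> G -> R) :
  \sum_x \sum_(y | adj x y) F x y = \sum_x \sum_(y | adj x y) F y x.
Proof.
rewrite (exchange_big_dep predT) //=; apply: eq_bigr => x _.
by apply: eq_bigl => y; rewrite adj_sym.
Qed.

Lemma connected_const (T : Type) (G : sgraph) (f : G -> T) :
  connected G -> (forall x y, adj x y -> f x = f y) -> forall x y, f x = f y.
Proof.
move=> cG fadj x y; have /connectP[p + ->] := cG x y.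
by elim: p x => //= z p IH x /andP[/fadj-> /IH].
Qed.

(* For [a = e d], the Dirichlet form [\sum_(x ~ y) |w x - e w y|^2] is
   [2 (d - e a) \sum |w x|^2 = 0]. *)
Lemma extremal_eigenfunction (G : sgraph) (d : nat) (e : C) (w : G -> C) :
  regular_of d G -> e ^+ 2 = 1 -> e \is Num.real ->
  (forall x, \sum_(y | adj x y) w y = e * d%:R * w x) ->
  forall x y, adj x y -> w x = e * w y.
Proof.
move=> dG e2 eR wA.
pose N := \sum_x `|w x| ^+ 2.
have eC : e^* = e by apply/CrealP.
have dC : (d%:R : C)^* = d%:R by apply/CrealP; rewrite realn.
have termE x y : `|w x - e * w y| ^+ 2 =
    `|w x| ^+ 2 + `|w y| ^+ 2 - e * (w x * (w y)^* + w y * (w x)^*).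
  rewrite !normCK rmorphB rmorphM /= eC -[w y * _ in RHS]mul1r -e2.
  by ring.
have sN : \sum_x \sum_(y | adj x y) `|w x| ^+ 2 = d%:R * N.
  by rewrite mulr_sumr; apply: eq_bigr => x _; apply: sum_adj_const.
have sX : \sum_x \sum_(y | adj x y) w y * (w x)^* = e * d%:R * N.
  rewrite mulr_sumr; apply: eq_bigr => x _.
  by rewrite -mulr_suml wA normCK mulrA.
have s0 : \sum_x \sum_(y | adj x y) `|w x - e * w y| ^+ 2 = 0.
  have -> : \sum_x \sum_(y | adj x y) `|w x - e * w y| ^+ 2 =
      \sum_x \sum_(y | adj x y) `|w x| ^+ 2 +
      \sum_x \sum_(y | adj x y) `|w y| ^+ 2 -
      e * (\sum_x \sum_(y | adj x y) w x * (w y)^* +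
           \sum_x \sum_(y | adj x y) w y * (w x)^*).
    rewrite -!big_split /= mulr_sumr -sumrB; apply: eq_bigr => x _.
    rewrite -!big_split /= mulr_sumr -sumrB; apply: eq_bigr => y _.
    exact: termE.
  rewrite [\sum_x \sum_(y | _) `|w y| ^+ 2]sum_adj_exchange.
  rewrite [\sum_x \sum_(y | _) w x * _]sum_adj_exchange sN sX.
  by rewrite -[d%:R * N]mul1r -e2; ring.
move=> x y xy; apply/eqP; rewrite -subr_eq0 -normr_eq0 -sqrf_eq0.
have ge0 (P : pred G) (F : G -> C) : 0 <= \sum_(z | P z) `|F z| ^+ 2.
  by apply: sumr_ge0 => z _; rewrite exprn_ge0.
move/eqP: s0; rewrite psumr_eq0 => [|z _]; last exact: ge0.
move=> /allP/(_ x (mem_index_enum _))/=.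
rewrite psumr_eq0 => [|z _]; last by rewrite exprn_ge0.
by move=> /allP/(_ y (mem_index_enum _)); rewrite xy.
Qed.

(** Eigenfunctions for [d] are constant by connectedness, and those for [-d] change sign along every
    edge; the two hypotheses on [f] make it orthogonal to both kinds. Every other eigenvalue has
    square at most [4 * (d - 1)]. *)
Lemma ramanujan_norm_bound (G : sgraph) (d : nat) (f : G -> C) (x0 : G) :
  ramanujan C G -> regular_of d G -> \sum_x f x = 0 ->
  (forall s : G -> C, (forall x y, adj x y -> s x = - s y) ->
     \sum_x f x * (s x)^* = 0) ->
  \sum_x `|\sum_(y | adj x y) f y| ^+ 2 <=
    4 * (d%:R - 1) * \sum_x `|f x| ^+ 2.
Proof.
move=> [cG [d' d'G ram]] dG f0 fs.
(* The vertex [x0] identifies the degree hidden in [ramanujan] with [d]. *)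
have dd : d' = d by rewrite -(d'G x0) (dG x0).
subst d'.
have := @hermitian_norm_bound C _ (adj_mx C G) (4 * (d%:R - 1))
  (\row_i f (enum_val i)) (adj_mx_herm G).
have reix (F : 'I_#|G| -> C) : \sum_i F i = \sum_x F (enum_rank x).
  by rewrite (reindex (@enum_rank G)) //; apply: onW_bij; apply: enum_rank_bij.
rewrite !reix.
under eq_bigr do rewrite adj_mxE.
under eq_bigr do under eq_bigr do rewrite mxE enum_rankK.
under [X in (_ -> _ <= _ * X) -> _]eq_bigr do rewrite mxE enum_rankK.
apply=> a w aR wN0 wA.
pose s x := w 0 (enum_rank x).
have sA x : \sum_(y | adj x y) s y = a * s x.
  by rewrite -adj_mxE wA mxE.
rewrite reix; under eq_bigr do rewrite mxE enum_rankK -/(s _).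
have [aE|aN] := eqVneq `|a| d%:R; last first.
  left; rewrite -real_normK //.
  have ev : eigenvalue (adj_mx C G) a by apply/eigenvalueP; exists w.
  have le := ram a ev aN.
  have := lerXn2r 2 (normr_ge0 a) (le_trans (normr_ge0 a) le) le.
  by rewrite exprMn sqrtCK -natrX.
right.
have [e [e2 eR ea]] : exists e : C, [/\ e = 1 \/ e = -1, e \is Num.real & a = e * d%:R].
  have [a0|a0] := real_ge0P aR.
    by exists 1; rewrite real1 -aE ger0_norm // mul1r; split; [left| |].
  by exists (-1); rewrite realN real1 -aE ler0_norm ?ltW // mulN1r opprK; split; [right| |].
have se : forall x y, adj x y -> s x = e * s y.
  apply: extremal_eigenfunction dG _ eR _ => [|x].
    by case: e2 => ->; rewrite ?sqrrN expr1n.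
  by rewrite sA ea.
case: e2 => e1; last first.
  by apply: fs => x y /se ->; rewrite e1 mulN1r.
have sc : forall x y, s x = s y.
  by apply: connected_const cG _ => x y /se; rewrite e1 mul1r.
by under eq_bigr do rewrite (sc _ x0); rewrite -mulr_suml f0 mul0r.
Qed.

Lemma ramanujan_int_bound (G : sgraph) (d : nat) (f : G -> int) (x0 : G) :
  ramanujan C G -> regular_of d G -> \sum_x f x = 0 ->
  (forall s : G -> C, (forall x y, adj x y -> s x = - s y) ->
     \sum_x (f x)%:~R * s x = 0) ->
  \sum_x (\sum_(y | adj x y) f y) ^+ 2 <= 4 * (d%:Z - 1) * \sum_x f x ^+ 2.
Proof.
move=> ram dG f0 fs.
have intn (z : int) : `|z%:~R| ^+ 2 = (z ^+ 2)%:~R :> C.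
  by rewrite real_normK ?realz // rmorphXn.
have := @ramanujan_norm_bound G d (fun x => (f x)%:~R) x0 ram dG.
rewrite -(rmorph_sum intr) /= f0 => /(_ erefl).
rewrite [\sum_x _](_ : _ = (\sum_x (\sum_(y | adj x y) f y) ^+ 2)%:~R); last first.
  rewrite [RHS]rmorph_sum /=; apply: eq_bigr => x _.
  by rewrite -(rmorph_sum intr) intn.
rewrite [\sum_x `|_| ^+ 2](_ : _ = (\sum_x f x ^+ 2)%:~R); last first.
  by rewrite [RHS]rmorph_sum /=; apply: eq_bigr => x _; rewrite intn.
have -> : 4 * (d%:R - 1) = (4 * (d%:Z - 1))%:~R :> C.
  by rewrite intrM intrB -pmulrn.
rewrite -intrM ler_int; apply => s sA.
(* Since [f] has real values, conjugating the vanishing sum puts the conjugate on [s]. *)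
have /(congr1 Num.conj) := fs s sA; rewrite conjC0 rmorph_sum => fs0.
rewrite -[RHS]fs0; apply: eq_bigr => x _.
by rewrite rmorphM /= rmorph_int.
Qed.
End Spectrum.
(** * Test vectors *)

Section NormBound.
Variables (H : sgraph) (j : nat) (q s D : int).
Hypothesis Hreg : regular_of j H.
Hypothesis Hbound : forall v : H -> int, \sum_x v x = 0 ->
  \sum_x (q * \sum_(y | adj x y) v y + s * v x) ^+ 2 <= D * \sum_x v x ^+ 2.

Lemma sum_delta (P : pred H) (x : H) (g : H -> int) :
  \sum_(y | P y) (y == x)%:R * g y = (P x)%:R * g x.
Proof.
rewrite big_mkcond (bigD1 x) //= eqxx big1 => [|y /negPf->]; last first.
  by rewrite mul0r if_same.
by case: (P x); rewrite !(mul0r, mul1r) addr0.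
Qed.

Lemma sum_const_card (c : int) : \sum_(x : H) c = #|H|%:R * c.
Proof. by rewrite sumr_const mulr_natl. Qed.

(** The test vector is n e_x - 1, with n the number of vertices. Its squared norm is n (n - 1), its
    image also has a squared norm divisible by n, and this factor is cancelled. *)
Lemma norm_bound_vertex (x : H) :
  #|H|%:R * (q ^+ 2 * j%:R + s ^+ 2) - (q * j%:R + s) ^+ 2 <= D * (#|H|%:R - 1).
Proof.
set n : int := #|H|%:R.
have n0 : 0 < n by rewrite ltr0n; apply/card_gt0P; exists x.
pose v y := n * (y == x)%:R - 1.
have sd1 (P : pred H) : \sum_(y | P y) (y == x)%:R = (P x)%:R :> int.
  by have := sum_delta P x (fun=> 1); rewrite mulr1 => <-; apply: eq_bigr => y; rewrite mulr1.
have := @Hbound v; rewrite /v.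
rewrite sumrB -mulr_sumr sd1 mulr1 sum_const_card mulr1 subrr => /(_ erefl).
have adjv y : \sum_(z | adj y z) (n * (z == x)%:R - 1) = n * (adj y x)%:R - j%:R.
  by rewrite sumrB -mulr_sumr sd1 (sum_adj_const y 1 Hreg) mulr1.
under eq_bigr do rewrite adjv.
set L := \sum_x0 _; set M := \sum_x0 (_ - _) ^+ 2.
have sa : \sum_y (adj y x)%:R = j%:R :> int.
  rewrite -[RHS]mulr1 -(sum_adj_const x 1 Hreg) [RHS]big_mkcond /=.
  by apply: eq_bigr => y _; rewrite adj_sym; case: adj.
have -> : M = n * (n - 1).
  have -> : M = \sum_y ((n ^+ 2 - 2 * n) * (y == x)%:R + 1).
    by apply: eq_bigr => y _; case: (y == x) => /=; ring.
  by rewrite big_split /= -mulr_sumr sd1 sum_const_card -/n /=; ring.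
have -> : L = n * (n * (q ^+ 2 * j%:R + s ^+ 2) - (q * j%:R + s) ^+ 2).
  have -> : L = \sum_y ((n ^+ 2 * q ^+ 2 - 2 * n * (q * j%:R + s) * q) * (adj y x)%:R +
     (n ^+ 2 * s ^+ 2 - 2 * n * (q * j%:R + s) * s) * (y == x)%:R + (q * j%:R + s) ^+ 2).
    apply: eq_bigr => y _; case: eqP => [->|_]; rewrite ?adj_irr //=; first by ring.
    by case: adj => /=; ring.
  rewrite !big_split /= -!mulr_sumr sd1 sa sum_const_card -/n /=; ring.
by rewrite mulrCA ler_pM2l.
Qed.

(* Cauchy-Schwarz: <v, q A v + s v>^2 <= |v|^2 |q A v + s v|^2. *)
Lemma norm_bound_rayleigh (v : H -> int) :
  \sum_x v x = 0 ->
  (q * \sum_x v x * (\sum_(y | adj x y) v y) + s * \sum_x v x ^+ 2) ^+ 2 <=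
  D * (\sum_x v x ^+ 2) ^+ 2.
Proof.
move=> v0; pose w x := q * \sum_(y | adj x y) v y + s * v x.
have := Hbound v0; rewrite -/(w _) => le.
set a := \sum_x v x ^+ 2 in le *; set W := \sum_x _ in le.
set b : int := _ + _.
have bE : b = \sum_x v x * w x.
  rewrite /b !mulr_sumr -big_split; apply: eq_bigr => x _ /=; rewrite /w; ring.
have a0 : 0 <= a by apply: sumr_ge0 => x _; apply: sqr_ge0.
have [az|ap] := eqVneq a 0.
  suff -> : b = 0 by rewrite az expr0n mulr0.
  rewrite bE big1 // => x _.
  have /eqP := az; rewrite psumr_eq0 => [|y _]; last exact: sqr_ge0.
  move=> /allP/(_ x (mem_index_enum _)).
  by rewrite /= sqrf_eq0 => /eqP ->; rewrite mul0r.
(* The squared norm of a w - b v, expanded: Cauchy-Schwarz over the integers, without square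
   roots. *)
have sq : 0 <= a * (a * W - b ^+ 2).
  have -> : a * (a * W - b ^+ 2) = \sum_x (a * w x - b * v x) ^+ 2.
    have -> : \sum_x (a * w x - b * v x) ^+ 2 =
       \sum_x (a ^+ 2 * w x ^+ 2 - 2 * a * b * (v x * w x) + b ^+ 2 * v x ^+ 2).
      by apply: eq_bigr => x _; ring.
    by rewrite big_split sumrB /= -!mulr_sumr -/a -bE -/W; ring.
  by apply: sumr_ge0 => x _; apply: sqr_ge0.
have ag : 0 < a by rewrite lt0r ap.
rewrite pmulr_rge0 // subr_ge0 in sq.
apply: le_trans sq _; rewrite expr2 mulrCA ler_pM2l //.
Qed.

(** The Rayleigh bound for v = n 1_S - m, where m = #|S| and [S] induces a [t]-regular subgraph: the
    squared norm of v is n m (n - m), its quadratic form under adjacency is n m (n t - m j), and the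
    factor (n m)^2 cancels. *)
Lemma norm_bound_set (S : {set H}) (t : nat) :
  (0 < #|S|)%N ->
  (forall x, x \in S -> \sum_(y | adj x y) (y \in S)%:R = t%:R :> int) ->
  (q * (#|H|%:R * t%:R - #|S|%:R * j%:R) + s * (#|H|%:R - #|S|%:R)) ^+ 2 <=
  D * (#|H|%:R - #|S|%:R) ^+ 2.
Proof.
move=> S0 St.
have H0 : (0 < #|H|)%N by apply: leq_trans S0 (max_card _).
set n : int := #|H|%:R; set m : int := #|S|%:R.
have n0 : 0 < n by rewrite ltr0n.
have m0 : 0 < m by rewrite ltr0n.
have sm : \sum_x (x \in S)%:R = m.
  rewrite /m -sum1_card natr_sum [RHS]big_mkcond /=.
  by apply: eq_bigr => x _; case: (x \in S).
have := @norm_bound_rayleigh (fun x => n * (x \in S)%:R - m).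
rewrite sumrB -mulr_sumr sm sum_const_card subrr => /(_ erefl).
have adjv x : \sum_(y | adj x y) (n * (y \in S)%:R - m) =
    n * (\sum_(y | adj x y) (y \in S)%:R) - j%:R * m.
  by rewrite sumrB -mulr_sumr (sum_adj_const x m Hreg).
under eq_bigr do rewrite adjv.
set a := \sum_x (_ - _) ^+ 2; set h := \sum_x _.
have -> : a = n * m * (n - m).
  have -> : a = \sum_x ((n ^+ 2 - 2 * n * m) * (x \in S)%:R + m ^+ 2).
    by apply: eq_bigr => x _; case: (x \in S) => /=; ring.
  by rewrite big_split /= -mulr_sumr sm sum_const_card -/n /=; ring.
have sc : \sum_x \sum_(y | adj x y) (y \in S)%:R = j%:R * m.
  rewrite sum_adj_exchange -sm mulr_sumr; apply: eq_bigr => x _.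
  exact: sum_adj_const.
have -> : h = n * m * (n * t%:R - m * j%:R).
  have -> : h = \sum_x ((n ^+ 2 * t%:R - n * m * j%:R) * (x \in S)%:R -
      m * n * (\sum_(y | adj x y) (y \in S)%:R) + m ^+ 2 * j%:R).
    apply: eq_bigr => x _; case: (boolP (x \in S)) => [xS|_] /=; last by ring.
    by rewrite (St _ xS); ring.
  by rewrite big_split sumrB /= -!mulr_sumr sm sc sum_const_card -/n /=; ring.
rewrite -[X in X ^+ 2 <= _](_ :
  n * m * (q * (n * t%:R - m * j%:R) + s * (n - m)) = _); last by ring.
rewrite exprMn [(n * m * (n - m)) ^+ 2]exprMn [leRHS]mulrCA ler_pM2l //.
by rewrite exprn_gt0 // mulr_gt0.
Qed.
End NormBound.

(** * Polynomial inequalities that turn the test vectors into bounds on [j] *)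

Section Numeric.
Implicit Types q j : int.

(** With k = q - 2 - j the inequality reads q k (q (j + 1) - 4 (q - 2)) <= -4 (q - 2). For j >= 3
    the left side is nonnegative and the right side negative. *)
Lemma edgeless_vertex_arith q j :
  3 <= q -> 0 <= j -> 1 <= q - 2 - j ->
  (q - 1) * (q ^+ 2 * j + q ^+ 2) - (q * j + q) ^+ 2 <=
    4 * (q * (q - 2 - j) - 1) * (q - 1 - 1) -> j <= 2.
Proof.
move=> q3 j0 k1 le; rewrite leNgt; apply/negP => j3.
have : q * (q - 2 - j) * (q * (j + 1) - 4 * (q - 2)) <= - 4 * (q - 2) by lia.
have : 0 <= q * (q - 2 - j) by rewrite mulr_ge0; lia.
have : 0 <= q * (j + 1) - 4 * (q - 2) by nia.
move=> h1 h2; have := mulr_ge0 h2 h1; lia.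
Qed.

Lemma edgeless_edge_arith1 q : 4 <= q ->
  (q * ((q - 1) * 1 - 2 * 1) + q * ((q - 1) - 2)) ^+ 2 <=
    4 * (q * (q - 2 - 1) - 1) * ((q - 1) - 2) ^+ 2 -> False.
Proof.
move=> q4.
have -> : q * ((q - 1) * 1 - 2 * 1) + q * ((q - 1) - 2) = 2 * q * (q - 3) by ring.
rewrite (_ : q - 1 - 2 = q - 3); last by ring.
rewrite exprMn ler_pM2r ?exprn_gt0 //; lia.
Qed.

Lemma edgeless_edge_arith2 q : 4 <= q ->
  (q * ((q - 1) * 1 - 2 * 2) + q * ((q - 1) - 2)) ^+ 2 <=
    4 * (q * (q - 2 - 2) - 1) * ((q - 1) - 2) ^+ 2 -> False.
Proof.
move=> q4 le.
(* This cubic is a quarter of the left side of [le] minus the right side; at q = 4 its value is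
   1. *)
have : 0 < 2 * q ^+ 3 - 16 * q ^+ 2 + 30 * q + 9 by nia.
by move: le; nia.
Qed.

Lemma complete_vertex_arith q j :
  3 <= q -> 0 <= j -> 1 <= q - 2 - j ->
  (q - 1) * (q ^+ 2 * j + 1 ^+ 2) - (q * j + 1) ^+ 2 <=
    4 * (q * (q - 1 - j) - 2) * (q - 1 - 1) ->
  j <= 3 /\ (j = 3 -> 9 <= q).
Proof.
move=> q3 j0 k1 le.
(* The hypothesis rearranged. For j >= 5 the two factors on the left are at least 2 q and q + 10,
   which is too much; j = 4 is excluded separately, and j = 3 survives from q = 9 on. *)
have E : q * (q - 1 - j) * (q * j - 4 * q + 10) <= 2 * q ^+ 2 - 11 * q + 18 by lia.
split=> [|j3]; last by subst j; nia.
rewrite leNgt; apply/negP => j4.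
have h1 : 2 * q <= q * (q - 1 - j) by nia.
have [j4'|j5] : j = 4 \/ 5 <= j by lia.
  by subst j; nia.
have h2 : q + 10 <= q * j - 4 * q + 10 by nia.
have : 2 * q * (q + 10) <= q * (q - 1 - j) * (q * j - 4 * q + 10).
  by apply: ler_pM => //; lia.
nia.
Qed.

Lemma complete_triangle_arith q : 8 <= q ->
  (q * ((q - 1) * 2 - 3 * 3) + 1 * ((q - 1) - 3)) ^+ 2 <=
    4 * (q * (q - 1 - 3) - 2) * ((q - 1) - 3) ^+ 2 -> False.
Proof.
move=> q8 le.
(* Again a quarter of the difference of the two sides of [le]; its value at q = 8 is 4. *)
have : 0 < 2 * q ^+ 3 - 25 * q ^+ 2 + 68 * q + 36 by nia.
by move: le; nia.
Qed.

(** Here 12 is the squared norm of (I - H)(e_x - e_y) and [h] its quadratic form under H. The bound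
    on [h] makes q h + 12 at most -(24 q - 12), whose square is too large. *)
Lemma complete_edge_arith q (h : int) : 5 <= q -> h <= -24 ->
  (q * h + 1 * 12) ^+ 2 <= 4 * (q * (q - 1 - 3) - 2) * 12 ^+ 2 -> False.
Proof.
move=> q5 h24 le.
have : (24 * q - 12) ^+ 2 <= (q * h + 1 * 12) ^+ 2.
  rewrite -[leRHS]sqrrN; apply: lerXn2r; rewrite ?nnegrE; nia.
nia.
Qed.
End Numeric.

(** * Indicator sums over edges and triangles *)

Lemma adj_neq (G : sgraph) (x y : G) : adj x y -> x != y.
Proof. by apply: contraTneq => ->; rewrite adj_irr. Qed.

Lemma sum_delta1 (G : sgraph) (P : pred G) (x : G) :
  \sum_(y | P y) (y == x)%:R = (P x)%:R :> int.
Proof.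
have := sum_delta P x (fun=> 1); rewrite mulr1 => <-.
by apply: eq_bigr => y _; rewrite mulr1.
Qed.

Lemma regular_has_neighbour (G : sgraph) (d : nat) (x : G) :
  regular_of d G -> (0 < d)%N -> exists y, adj x y.
Proof.
by move=> /(_ x) <- /card_gt0P[y]; rewrite inE => xy; exists y.
Qed.

Lemma in_set2_nat (T : finType) (x y z : T) : x != y ->
  (z \in [set x; y])%:R = (z == x)%:R + (z == y)%:R :> int.
Proof.
move=> xy; rewrite !inE; case: eqP => [->|_]; case: eqP => [e|_] //=.
by rewrite e eqxx in xy.
Qed.

Lemma edge_sum (G : sgraph) (x y : G) : adj x y -> forall z, z \in [set x; y] ->
  \sum_(w | adj z w) (w \in [set x; y])%:R = 1%:R :> int.
Proof.
move=> xy z zS; have xNy := adj_neq xy.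
under eq_bigr do rewrite in_set2_nat //.
rewrite big_split /= !sum_delta1; move: zS; rewrite !inE => /orP[]/eqP->.
  by rewrite adj_irr xy.
by rewrite adj_irr adj_sym xy.
Qed.

Lemma in_set3_nat (G : sgraph) (x y z w : G) : adj x y -> adj y z -> adj x z ->
  (w \in [set x; y; z])%:R = (w == x)%:R + (w == y)%:R + (w == z)%:R :> int.
Proof.
move=> /adj_neq xy /adj_neq yz /adj_neq xz; rewrite !inE.
case: eqP => [->|_] /=; first by rewrite (negPf xy) (negPf xz) !addr0.
case: eqP => [->|_] /=; first by rewrite (negPf yz) addr0.
by rewrite !add0r.
Qed.

Lemma triangle_sum (G : sgraph) (x y z : G) : adj x y -> adj y z -> adj x z ->
  forall u, u \in [set x; y; z] ->
  \sum_(w | adj u w) (w \in [set x; y; z])%:R = 2%:R :> int.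
Proof.
move=> xy yz xz u uS.
under eq_bigr do rewrite in_set3_nat //.
rewrite !big_split /= !sum_delta1; move: uS; rewrite !inE.
case/orP=> [/orP[]|] /eqP->; rewrite adj_irr.
- by rewrite xy xz.
- by rewrite adj_sym xy yz.
by rewrite adj_sym xz adj_sym yz.
Qed.

Lemma triangle_card (G : sgraph) (x y z : G) : adj x y -> adj y z -> adj x z ->
  #|[set x; y; z]| = 3%N.
Proof.
move=> /adj_neq xy /adj_neq yz /adj_neq xz.
by rewrite -setUA cardsU1 cards2 !inE negb_or xy xz yz.
Qed.

(** The vector at a vertex leaves j <= 2, and the indicator of an edge then excludes 1 and 2. For j
    >= 1 the positive degree q - 2 - j forces q >= 4, as the edge inequalities require. *)
Lemma edgeless_complement (H : sgraph) (j : nat) (q : int) (x0 : H) :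
  regular_of j H -> q = #|H|%:R + 1 -> 3 <= q -> 1 <= q - 2 - j%:R ->
  (forall v : H -> int, \sum_x v x = 0 ->
   \sum_x (q * \sum_(y | adj x y) v y + q * v x) ^+ 2 <=
     4 * (q * (q - 2 - j%:R) - 1) * \sum_x v x ^+ 2) ->
  j = 0%N.
Proof.
move=> jH qE q3 k1 Hb.
have nE : #|H|%:R = q - 1 :> int by rewrite qE addrK.
have := norm_bound_vertex jH Hb x0; rewrite nE.
move=> /(edgeless_vertex_arith q3 (ler0n _ _) k1) j2.
have [//|j0] := posnP j.
have [y xy] := regular_has_neighbour x0 jH j0.
have c2 : #|[set x0; y]| = 2%N by rewrite cards2 (adj_neq xy).
have := norm_bound_set jH Hb (S := [set x0; y]) (t := 1); rewrite c2 nE.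
move=> /(_ isT (edge_sum xy)).
have [j1|j1] : j = 1%N \/ j = 2%N by lia.
  by subst j => /edgeless_edge_arith1 []; lia.
by subst j => /edgeless_edge_arith2 []; lia.
Qed.

(** A triangle serves as the set [S] if there is one. Otherwise an edge xy has no common neighbours
    of its ends, and (I - H)(e_x - e_y) has Rayleigh quotient at most -2. *)
Lemma cubic_complement (H : sgraph) (q : int) (x0 : H) :
  regular_of 3 H -> q = #|H|%:R + 1 -> 9 <= q ->
  (forall v : H -> int, \sum_x v x = 0 ->
   \sum_x (q * \sum_(y | adj x y) v y + 1 * v x) ^+ 2 <=
     4 * (q * (q - 1 - 3) - 2) * \sum_x v x ^+ 2) ->
  False.
Proof.
move=> jH qE q9 Hb.
have nE : #|H|%:R = q - 1 :> int by rewrite qE addrK.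
have [/existsP[x /existsP[y /existsP[z /and3P[xy yz xz]]]]|tf] :=
    boolP [exists x : H, [exists y, [exists z, [&& adj x y, adj y z & adj x z]]]].
  have := norm_bound_set jH Hb (S := [set x; y; z]) (t := 2).
  rewrite triangle_card // nE => /(_ isT (triangle_sum xy yz xz)).
  by apply: complete_triangle_arith; lia.
have trif (x y z : H) : adj x y -> adj y z -> adj x z = false.
  move=> xy yz; apply/negP => xz; case/negP: tf.
  by apply/existsP; exists x; apply/existsP; exists y; apply/existsP; exists z; apply/and3P.
have [y xy] := regular_has_neighbour x0 jH isT; move: xy; set x := x0 => xy.
have yx : adj y x by rewrite adj_sym.
(* v = (I - H)(e_x - e_y) *)
pose v (z : H) : int := (z == x)%:R - (z == y)%:R - (adj x z)%:R + (adj y z)%:R.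
pose Av (z : H) : int := \sum_(w | adj z w) v w.
(* The number of common neighbours of [u] and [z], an entry of H^2. *)
pose c (u z : H) : int := \sum_(w | adj z w) (adj u w)%:R.
have c_sum (g : H -> int) u : \sum_z (adj u z)%:R * g z = \sum_(z | adj u z) g z.
  rewrite [RHS]big_mkcond; apply: eq_bigr => z _.
  by case: adj; rewrite ?mul1r ?mul0r.
have deg (u : H) : \sum_z (adj u z)%:R = 3 :> int.
  transitivity (\sum_(z | adj u z) (1 : int)).
    by rewrite [RHS]big_mkcond; apply: eq_bigr => z _; case: adj.
  by rewrite (sum_adj_const _ _ jH) mulr1.
have vsum (g : H -> int) : \sum_z v z * g z =
    g x - g y - \sum_(z | adj x z) g z + \sum_(z | adj y z) g z.
  rewrite -!c_sum -[g x]mul1r -[g y]mul1r.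
  have := sum_delta predT x g; have := sum_delta predT y g => /= <- <-.
  rewrite -!sumrB -big_split; apply: eq_bigr => z _ /=; rewrite /v; ring.
have v0 : \sum_z v z = 0.
  by rewrite big_split /= !sumrB !sum_delta1 !deg.
have AvE z : Av z = (adj z x)%:R - (adj z y)%:R - c x z + c y z.
  by rewrite /Av big_split /= !sumrB !sum_delta1.
have cge0 u z : 0 <= c u z by apply: sumr_ge0.
have cge1 (u z w : H) : adj u w -> adj z w -> 1 <= c u z.
  move=> uw zw; rewrite /c (bigD1 w) //= uw lerDl; exact: sumr_ge0.
have cc u : c u u = 3.
  rewrite /c -[RHS](deg u) [LHS]big_mkcond; apply: eq_bigr => w _.
  by case: adj.
have c0 (u z : H) : adj u z -> c u z = 0.
  move=> uz; apply: big1 => w zw; by rewrite (trif _ _ _ uz zw).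
have Avx : Av x = -4 by rewrite AvE adj_irr xy cc (c0 _ _ yx).
have Avy : Av y = 4 by rewrite AvE adj_irr yx cc (c0 _ _ xy).
(* Three neighbours with values at least 2, one of them 4, give at least 2 * 3 + 2. *)
have sum_ge (u w : H) (g : H -> int) : adj u w -> g w = 4 ->
    (forall z, adj u z -> 2 <= g z) -> 8 <= \sum_(z | adj u z) g z.
  move=> uw gw g2; rewrite -c_sum.
  have -> : 8%:R = 2%:R * \sum_z (adj u z)%:R + 2%:R * \sum_z (z == w)%:R :> int.
    by rewrite deg sum_delta1.
  rewrite !mulr_sumr -big_split; apply: ler_sum => z _ /=.
  have [->|_] := eqVneq z w; first by rewrite uw gw.
  by case uz : (adj u z) => /=; rewrite ?mul1r ?mul0r ?mulr0 ?addr0 ?mulr1 ?g2.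
have Sx : 8 <= \sum_(z | adj x z) Av z.
  apply: (sum_ge x y) => // z xz.
  rewrite AvE adj_sym xz (c0 _ _ xz) [adj z y](_ : _ = false); last first.
    by rewrite adj_sym (trif _ _ _ yx xz).
  have := cge1 y z x yx; rewrite adj_sym xz => /(_ isT); lia.
(* Exchanging x and y changes the sign of [v], so [sum_ge] applies to [- Av]. *)
have Sy : 8 <= \sum_(z | adj y z) - Av z.
  apply: (sum_ge y x); rewrite ?Avx // => z yz.
  rewrite AvE [adj z y]adj_sym yz (c0 _ _ yz) [adj z x](_ : _ = false); last first.
    by rewrite adj_sym (trif _ _ _ xy yz).
  have := cge1 x z y xy; rewrite adj_sym yz => /(_ isT); lia.
rewrite sumrN in Sy.
(* The four contributions are -4, -4, at most -8 and at most -8. *)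
have h24 : \sum_z v z * Av z <= -24.
  rewrite vsum Avx Avy; move: Sx Sy.
  by move: (\sum_(z | adj x z) Av z) (\sum_(z | adj y z) Av z) => a b; lia.
have vx : v x = 2 by rewrite /v eqxx (negPf (adj_neq xy)) adj_irr yx.
have vy : v y = -2 by rewrite /v eqxx eq_sym (negPf (adj_neq xy)) adj_irr xy.
have a12 : \sum_z v z ^+ 2 = 12.
  rewrite (eq_bigr (fun z => v z * v z)) // vsum -/(Av x) -/(Av y).
  by rewrite Avx Avy vx vy.
have := norm_bound_rayleigh Hb v0; rewrite a12.
by apply: complete_edge_arith => //; lia.
Qed.

(** * Two-regular graphs and their cycles *)

Lemma regular2_sum (G : sgraph) (x a b : G) (g : G -> int) :
  regular_of 2 G -> adj x a -> adj x b -> a != b ->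
  \sum_(y | adj x y) g y = g a + g b.
Proof.
move=> G2 xa xb ab.
have nE : [set a; b] = [set y | adj x y].
  apply/eqP; rewrite eqEcard G2 cards2 ab leqnn andbT.
  by apply/subsetP => y; rewrite !inE => /orP[]/eqP->.
have -> : \sum_(y | adj x y) g y = \sum_(y in [set a; b]) g y.
  by apply: eq_bigl => y; rewrite nE inE.
by rewrite big_setU1 ?inE //= big_set1.
Qed.

Lemma regular2_neighbour (G : sgraph) (x a b z : G) :
  regular_of 2 G -> adj x a -> adj x b -> a != b -> adj x z -> z = a \/ z = b.
Proof.
move=> G2 xa xb ab xz.
have nE : [set a; b] = [set y | adj x y].
  apply/eqP; rewrite eqEcard G2 cards2 ab leqnn andbT.
  by apply/subsetP => y; rewrite !inE => /orP[]/eqP->.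
have : z \in [set a; b] by rewrite nE inE.
by rewrite !inE => /orP[]/eqP; [left|right].
Qed.

(* A longest path in a 2-regular graph is closed under adjacency, and its two
   ends can only be adjacent to each other. *)
Lemma regular2_cycle (G : sgraph) (x0 : G) :
  regular_of 2 G -> (2 < #|G|)%N ->
  (forall (S : {set G}) z, z \in S -> (forall x y, x \in S -> adj x y -> y \in S) ->
     S = [set: G]) ->
  exists s : seq G, [/\ uniq s, size s = #|G|, forall x, x \in s &
    forall i, (i < #|G|)%N -> adj (nth x0 s i) (nth x0 s (i.+1 %% #|G|))].
Proof.
move=> G2 n3 closedT.
pose P m := [exists t : m.-tuple G, uniq t && sorted (@adj G) t].
have P1 : exists m, P m by exists 1%N; apply/existsP; exists [tuple x0].
have Pmax m : P m -> (m <= #|G|)%N.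
  by case/existsP=> t /andP[/card_uniqP ut _]; rewrite -(size_tuple t) -ut max_card.
have [m /existsP[t /andP[ut st]] mmax] := ex_maxnP P1 Pmax.
have maxP (s : seq G) : uniq s -> sorted (@adj G) s -> (size s <= m)%N.
  by move=> us ss; apply: mmax; apply/existsP; exists (in_tuple s); apply/andP.
pose f i := nth x0 t i.
have sz : size t = m by rewrite size_tuple.
have fadj i : (i.+1 < m)%N -> adj (f i) (f i.+1).
  by move=> im; apply: (sortedP x0 st); rewrite sz.
have fi i k : (i < m)%N -> (k < m)%N -> (f i == f k) = (i == k).
  by move=> il kl; rewrite nth_uniq ?sz.
have ft i : (i < m)%N -> f i \in t by move=> il; rewrite mem_nth ?sz.
have m0 : (0 < m)%N by apply: (maxP [:: x0]).
(* A neighbour outside the path could be put in front of it, against maximality; [last] is the same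
   at the other end. *)
have first y : adj (f 0%N) y -> y \in t.
  move=> fy; apply/negPn/negP => yt; have := maxP (y :: t).
  rewrite /= yt ut sz ltnn => /(_ isT) e; suff: false by []; apply: e.
  move: fy st; rewrite /f; case: (tval t) => [|a l] //=.
  by rewrite adj_sym => -> ->.
have last y : adj (f m.-1) y -> y \in t.
  move=> fy; apply/negPn/negP => yt; have := maxP (rcons t y).
  rewrite rcons_uniq yt ut size_rcons sz ltnn => /(_ isT) e; suff: false by []; apply: e.
  move: fy st; rewrite /f -[X in X.-1]sz nth_last; case: (tval t) => [|a l] //=.
  by rewrite rcons_path => -> ->.
(* An interior vertex has both its neighbours on the path, next to it. *)
have mid i y : (0 < i)%N -> (i.+1 < m)%N -> adj (f i) y -> y = f i.-1 \/ y = f i.+1.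
  case: i => // i _ im fy; apply: (regular2_neighbour G2) fy; rewrite ?fadj //.
    by rewrite adj_sym fadj // ltnW.
  by rewrite fi; lia.
have tcl x y : x \in t -> adj x y -> y \in t.
  move=> xt; have := xt; rewrite -index_mem sz => il.
  have -> : x = f (index x t) by rewrite /f nth_index.
  move: il; set i := index x t => il.
  have [->|i0] := posnP i; first exact: first.
  have [->|im] := eqVneq i m.-1; first exact: last.
  by case/mid=> //; [lia|move=> ->; apply: ft; lia..].
have tT x : x \in t.
  have cl : [set x | x \in t] = [set: G].
    apply: (closedT _ (f 0%N)) => [|y z]; first by rewrite inE ft.
    by rewrite !inE; apply: tcl.
  by have := in_setT x; rewrite -cl inE.
have mn : m = #|G|.
  by rewrite -sz -(card_uniqP ut); apply: eq_card => x; rewrite tT.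
exists t; rewrite -mn; split=> // i im; rewrite -/(f _) -/(f _).
have [im1|im1] := ltnP i.+1 m; first by rewrite modn_small // fadj.
have -> : i = m.-1 by lia.
rewrite prednK // modnn adj_sym.
(* The first vertex has a second neighbour besides [f 1]. By [mid] it is not interior, so it is the
   last vertex and the path closes up. *)
have : (1 < #|[set y | adj (f 0%N) y]|)%N by rewrite G2.
rewrite (cardsD1 (f 1%N)) inE fadj; last by lia.
rewrite add1n ltnS => /card_gt0P[y]; rewrite !inE => /andP[yf1 fy].
have := tT y; rewrite -index_mem sz; set k := index y t => km.
have yE : y = f k by rewrite /f nth_index.
have [kl|kl] := eqVneq k m.-1; first by rewrite -kl -yE.
have k0 : k != 0%N by apply: contraTneq fy => k0; rewrite yE k0 adj_irr.
have k1 : k != 1%N by apply: contraNneq yf1 => k1; rewrite yE k1.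
have /mid : adj (f k) (f 0%N) by rewrite -yE adj_sym.
by case; [lia|lia|move/eqP; rewrite fi; lia..].
Qed.

Lemma sum_sign_double m : \sum_(0 <= i < m.*2) (-1) ^+ i = 0%R :> int.
Proof.
elim: m => [|m IH]; first by rewrite big_geq.
by rewrite doubleS !big_nat_recr //= IH exprS; ring.
Qed.

(** The degree 2 and an eigenvalue -2 would give q H + 1 the values 2 q + 1 and -(2 q - 1), whose
    squares both exceed 4 (q (q - 3) - 2). The first makes H a single cycle; an alternating vector
    exploits the second, exactly or nearly. *)
Lemma regular2_complement (H : sgraph) (q : int) (x0 : H) :
  regular_of 2 H -> q = #|H|%:R + 1 -> 5 <= q ->
  (forall v : H -> int, \sum_x v x = 0 ->
   \sum_x (q * \sum_(y | adj x y) v y + 1 * v x) ^+ 2 <=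
     4 * (q * (q - 1 - 2) - 2) * \sum_x v x ^+ 2) ->
  False.
Proof.
move=> H2 qE q5 Hb.
have nE : #|H|%:R = q - 1 :> int by rewrite qE addrK.
have n4 : (4 <= #|H|)%N by lia.
(* For a proper closed [S] one has t = j = 2, so n - #|S| factors out and leaves (2 q + 1)^2 <= 4 (q
   (q - 3) - 2). *)
have closedT (S : {set H}) z : z \in S ->
    (forall x y, x \in S -> adj x y -> y \in S) -> S = [set: H].
  move=> S0 Scl; apply/eqP; rewrite eqEcard subsetT cardsT /= leqNgt.
  apply/negP => lt.
  have := norm_bound_set H2 Hb (S := S) (t := 2).
  have -> : (0 < #|S|)%N by apply/card_gt0P; exists z.
  have St x : x \in S -> \sum_(y | adj x y) (y \in S)%:R = 2%:R :> int.
    move=> xS; rewrite -[RHS]mulr1 -(sum_adj_const x 1 H2).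
    by apply: eq_bigr => y xy; rewrite (Scl x y xS xy).
  move=> /(_ isT St).
  rewrite (_ : q * _ + _ = (2 * q + 1) * (#|H|%:R - #|S|%:R)); last by ring.
  rewrite exprMn ler_pM2r ?exprn_gt0 ?subr_gt0 ?ltr_nat //; nia.
have [s [us ss sT sadj]] := regular2_cycle x0 H2 (ltnW n4) closedT.
(* The form [m.+3] makes the wrap-around explicit: the last index is [m.+2], with neighbours [m.+1]
   and 0. *)
have [m nm] : exists m, #|H| = m.+3 by exists (#|H| - 3)%N; lia.
rewrite nm in ss sadj.
pose f i := nth x0 s i.
have fi i k : (i < m.+3)%N -> (k < m.+3)%N -> (f i == f k) = (i == k).
  by move=> ilt klt; rewrite nth_uniq ?ss.
have sumE (F : H -> int) : \sum_x F x = \sum_(0 <= i < m.+3) F (f i).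
  rewrite -ss -(big_nth x0 predT F) -big_enum; apply: perm_big.
  by apply: uniq_perm; rewrite ?enum_uniq // => x; rewrite mem_enum sT.
have nbr_first (g : H -> int) : \sum_(y | adj (f 0%N) y) g y = g (f 1%N) + g (f m.+2).
  apply: regular2_sum => //; last by rewrite fi.
    by have := sadj 0%N isT; rewrite modn_small.
  by have := sadj m.+2 (ltnSn _); rewrite modnn adj_sym.
have nbr_last (g : H -> int) : \sum_(y | adj (f m.+2) y) g y = g (f m.+1) + g (f 0%N).
  apply: regular2_sum => //; last by rewrite fi; lia.
    by have := sadj m.+1 (ltnW (ltnSn _)); rewrite modn_small // adj_sym.
  by have := sadj m.+2 (ltnSn _); rewrite modnn.
have nbr_mid (g : H -> int) i : (i.+2 < m.+3)%N ->
    \sum_(y | adj (f i.+1) y) g y = g (f i) + g (f i.+2).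
  move=> ilt; apply: regular2_sum => //; last by rewrite fi; lia.
    have il : (i < m.+3)%N by lia.
    have := sadj i il; rewrite modn_small; last by lia.
    by rewrite adj_sym.
  have il : (i.+1 < m.+3)%N by lia.
  by have := sadj i.+1 il; rewrite modn_small.
have mq : m%:R = q - 4 :> int by lia.
(* For [m] odd the cycle is even, the signs close up, and [v] is an eigenvector of H for -2. *)
have [mo|me] := boolP (odd m).
  pose v (x : H) : int := (-1) ^+ index x s.
  have vf i : (i < m.+3)%N -> v (f i) = (-1) ^+ i.
    by move=> il; rewrite /v /f index_uniq ?ss.
  have s1 : (-1) ^+ m.+1 = 1%R :> int by rewrite -signr_odd /= mo.
  have s2 : (-1) ^+ m.+2 = -1%R :> int by rewrite exprS s1 mulr1.
  have vs : \sum_x v x = 0.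
    rewrite sumE; apply: etrans (sum_sign_double m.+3./2).
    rewrite even_halfK /= ?negbK //.
    by apply: eq_big_nat => i /andP[_ il]; rewrite vf.
  have := Hb v vs; rewrite !sumE.
  rewrite (eq_big_nat _ _ (F2 := fun=> (2 * q - 1) ^+ 2)); last first.
    move=> i /andP[_ il]; have [->|i0] := posnP i.
      by rewrite nbr_first !vf // s2 expr0 expr1; ring.
    have [->|im] := eqVneq i m.+2.
      by rewrite nbr_last !vf // s2 s1 expr0; ring.
    case: i i0 il im => // i _ il im.
    rewrite nbr_mid ?vf; try lia.
    rewrite (_ : q * _ + _ = (2 * q - 1) * (-1) ^+ i); last by rewrite !exprS; ring.
    by rewrite exprMn sqrr_sign mulr1.
  rewrite [X in _ <= _ * X](eq_big_nat _ _ (F2 := fun=> 1)) => [|i /andP[_ il]]; last first.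
    by rewrite vf // sqrr_sign.
  rewrite !sumr_const_nat subn0; nia.
(* On an odd cycle the last vertex gets 0, and the other [m.+2] signs cancel. The image is 0 there,
   has absolute value q - 1 at its two neighbours and 2 q - 1 elsewhere. *)
pose v (x : H) : int := if x == f m.+2 then 0 else (-1) ^+ index x s.
have vl : v (f m.+2) = 0 by rewrite /v eqxx.
have vf i : (i < m.+2)%N -> v (f i) = (-1) ^+ i.
  by move=> il; rewrite /v fi ?ltn_eqF ?index_uniq ?ss //; lia.
have vs : \sum_x v x = 0.
  rewrite sumE big_nat_recr //= vl addr0.
  apply: etrans (sum_sign_double m.+2./2).
  rewrite even_halfK /= ?negbK //.
  by apply: eq_big_nat => i /andP[_ il]; rewrite vf.
have := Hb v vs; rewrite !sumE.
rewrite !(big_nat_recr m.+2) //= nbr_last vl !vf // (big_nat_recr m.+1) //=.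
rewrite big_nat_recl //= nbr_first nbr_mid // vl !vf //.
have sm : (-1) ^+ m = 1%R :> int by rewrite -signr_odd (negPf me).
rewrite !exprS sm.
rewrite [X in _ + X + _ + _ <= _](eq_big_nat _ _ (F2 := fun=> (2 * q - 1) ^+ 2)); last first.
  move=> i /andP[_ il]; rewrite nbr_mid ?vf; try lia.
  rewrite (_ : q * _ + _ = (2 * q - 1) * (-1) ^+ i); last by rewrite !exprS; ring.
  by rewrite exprMn sqrr_sign mulr1.
rewrite [X in _ <= _ * (X + _)](eq_big_nat _ _ (F2 := fun=> 1)) => [|i /andP[_ il]]; last first.
  by rewrite vf // sqrr_sign.
(* With m = q - 4, the sum (q - 4) (2 q - 1)^2 + 2 (q - 1)^2 exceeds 4 (q (q - 3) - 2) (q - 2) by 2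
   q^2 - 3 q - 18, which is positive for q >= 5. *)
rewrite !sumr_const_nat !subn0; nia.
Qed.

(** * Lexicographic products *)

Lemma complement_sym (G : sgraph) : symmetric (fun x y : G => (x != y) && ~~ adj x y).
Proof. by move=> x y; rewrite eq_sym adj_sym. Qed.
Lemma complement_irr (G : sgraph) : irreflexive (fun x y : G => (x != y) && ~~ adj x y).
Proof. by move=> x; rewrite eqxx. Qed.
Definition complement (G : sgraph) : sgraph :=
  SGraph (@complement_sym G) (@complement_irr G).

Lemma complement_regular (G : sgraph) (k : nat) :
  regular_of k G -> regular_of (#|G| - k.+1) (complement G).
Proof.
move=> kG x; rewrite -(kG x).
have <- : #|(x : G) |: [set y : G | @adj G x y]| = #|[set y | @adj G x y]|.+1.
  by rewrite cardsU1 inE adj_irr.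
rewrite -(cardsC ((x : G) |: [set y : G | @adj G x y])) addKn; apply: eq_card => y.
by rewrite !inE negb_or /= eq_sym.
Qed.

Lemma sum_split_adj (V : nmodType) (G : sgraph) (v : G -> V) (x : G) :
  \sum_y v y =
  v x + (\sum_(y | adj x y) v y + \sum_(y | @adj (complement G) x y) v y).
Proof.
rewrite (bigD1 x) //=; congr (_ + _).
rewrite (bigID (adj x)) /=; congr (_ + _).
  apply: eq_bigl => y; have := @adj_neq G x y; rewrite eq_sym.
  by case: adj => [->|_]; rewrite ?andbT ?andbF.
by apply: eq_bigl => y; rewrite eq_sym.
Qed.

(** The all-ones matrix is I + A + H, with A and H the adjacency of the graph and of its complement;
    it kills vectors of sum zero, so A acts on them as -(I + H). *)
Lemma sum_complement (G : sgraph) (v : G -> int) (x : G) :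
  \sum_y v y = 0 ->
  \sum_(y | adj x y) v y = - (v x + \sum_(y | @adj (complement G) x y) v y).
Proof.
move=> v0; apply/eqP; rewrite -addr_eq0; apply/eqP; apply: etrans v0.
by rewrite (sum_split_adj v x) addrCA.
Qed.

Lemma regular_sum_card (G : sgraph) (d : nat) :
  (forall x : G, (\sum_(y | adj x y) 1 = d)%N) -> regular_of d G.
Proof.
move=> H x; rewrite -(H x) -sum1_card; apply: eq_bigl => y; by rewrite inE.
Qed.

Lemma regular_card_sum (G : sgraph) (d : nat) (x : G) :
  regular_of d G -> (\sum_(y | adj x y) 1 = d)%N.
Proof.
by move=> /(_ x) <-; rewrite -sum1_card; apply: eq_bigl => y; rewrite inE.
Qed.

Lemma edgeless_regular n : regular_of 0 (edgeless_graph n).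
Proof. by move=> x; apply: eq_card0 => y; rewrite inE. Qed.

Lemma complete_regular n : regular_of n.-1 (complete_graph n).
Proof.
move=> x; rewrite -[n in RHS]card_ord -[#|'I_n|]cardsT.
rewrite (cardsD1 x [set: 'I_n]) inE /=; apply: eq_card => y.
by rewrite !inE andbT /adj /= /complete_adj eq_sym.
Qed.

Section Lex.
Variables Y Z : sgraph.

Lemma lex_adjE (u w : lex_product Y Z) :
  adj u w = adj u.1 w.1 || (u.1 == w.1) && adj u.2 w.2.
Proof. by []. Qed.

Lemma lex_adjl (y y' : Y) (z z' : Z) :
  adj y y' -> @adj (lex_product Y Z) (y, z) (y', z').
Proof. by rewrite lex_adjE /= => ->. Qed.

Lemma lex_adjr (y : Y) (z z' : Z) :
  adj z z' -> @adj (lex_product Y Z) (y, z) (y, z').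
Proof. by rewrite lex_adjE /= eqxx => ->; rewrite orbT. Qed.

(** The adjacency operator of the product is the sum of A_Y tensor J and I tensor A_Z; irreflexivity
    of Y keeps the two kinds of edges disjoint. *)
Lemma sum_lex (V : nmodType) (F : lex_product Y Z -> V) (u : lex_product Y Z) :
  \sum_(w | adj u w) F w =
  \sum_(y | adj u.1 y) \sum_z F (y, z) + \sum_(z | adj u.2 z) F (u.1, z).
Proof.
rewrite big_mkcond.
rewrite (eq_bigr (fun w : Y * Z => (if adj u.1 w.1 then F (w.1, w.2) else 0) +
    (if (w.1 == u.1) && adj u.2 w.2 then F (w.1, w.2) else 0))); last first.
  move=> [y z] _; rewrite lex_adjE /= [u.1 == y]eq_sym.
  case: eqP => [->|_] /=; first by rewrite adj_irr /= add0r.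
  by rewrite orbF addr0.
rewrite big_split /=; congr (_ + _).
  rewrite -(pair_bigA _ (fun y z => if adj u.1 y then F (y, z) else 0)) /=.
  by rewrite [RHS]big_mkcond; apply: eq_bigr => y _; case: adj; rewrite ?big1_eq.
rewrite -(pair_bigA _ (fun y z => if (y == u.1) && adj u.2 z then F (y, z) else 0)) /=.
rewrite (bigD1 u.1) //= [X in _ + X]big1 ?addr0 => [|y /negPf->]; last by rewrite big1_eq.
by rewrite [RHS]big_mkcond; apply: eq_bigr => z _; rewrite eqxx.
Qed.

Lemma lex_regular (k l : nat) :
  regular_of k Y -> regular_of l Z -> regular_of (#|Z| * k + l) (lex_product Y Z).
Proof.
move=> kY lZ; apply: regular_sum_card => u.
rewrite (sum_lex (fun=> 1%N)) (regular_card_sum _ lZ); congr (_ + _)%N.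
rewrite -(regular_card_sum u.1 kY) big_distrr /=.
by apply: eq_bigr => y _; rewrite sum_nat_const.
Qed.

(** Fibres may have no edges, so two points of one fibre are joined through a neighbouring fibre. *)
Lemma lex_connected : connected Y ->
  (forall y : Y, exists y', adj y y') -> connected (lex_product Y Z).
Proof.
move=> cY nbr [y z] [y' z'].
have mv : connect (@adj (lex_product Y Z)) (y, z) (y', z).
  have /connectP[p + ->] := cY y y'.
  elim: p y => //= a p IH y /andP[ya /IH]; apply: connect_trans.
  exact/connect1/lex_adjl.
apply: connect_trans mv _; have [a ya] := nbr y'.
apply: (@connect_trans _ _ (a, z)); apply: connect1; apply: lex_adjl => //.
by rewrite adj_sym.
Qed.

(** The test function is constant on fibres; all sums acquire the factor #|Z|, which cancels. The
    last hypothesis is orthogonality to the eigenfunctions of -d, stated through fibre sums. *)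
Lemma lex_norm_bound (C : numClosedFieldType) (k l : nat) (v : Y -> int)
    (x0 : Y) (z0 : Z) :
  ramanujan C (lex_product Y Z) -> regular_of k Y -> regular_of l Z ->
  \sum_y v y = 0 ->
  (forall s : Y -> Z -> C,
     (forall y z y' z', adj y y' -> s y z = - s y' z') ->
     (forall y z z', adj z z' -> s y z = - s y z') ->
     \sum_y (v y)%:~R * \sum_z s y z = 0) ->
  \sum_y (#|Z|%:R * \sum_(y' | adj y y') v y' + l%:R * v y) ^+ 2 <=
    4 * (#|Z|%:R * k%:R + l%:R - 1) * \sum_y v y ^+ 2.
Proof.
move=> ram kY lZ v0 orth.
have Z0 : 0 < #|Z|%:R :> int by rewrite ltr0n; apply/card_gt0P; exists z0.
have sumE (F : Y -> int) : \sum_(u : Y * Z) F u.1 = #|Z|%:R * \sum_y F y.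
  rewrite -(pair_bigA _ (fun y _ => F y)) mulr_sumr /=.
  by apply: eq_bigr => y _; rewrite sumr_const mulr_natl.
have := @ramanujan_int_bound C _ _ (fun u : lex_product Y Z => v u.1) (x0, z0)
  ram (lex_regular kY lZ).
rewrite sumE v0 mulr0 => /(_ erefl).
have adjE (u : lex_product Y Z) : \sum_(w | adj u w) v w.1 =
   #|Z|%:R * \sum_(y' | adj u.1 y') v y' + l%:R * v u.1.
  rewrite (sum_lex (fun w => v w.1)) /= (sum_adj_const _ _ lZ) mulr_sumr.
  by congr (_ + _); apply: eq_bigr => y _; rewrite sumr_const mulr_natl.
under eq_bigr do rewrite adjE.
rewrite (sumE (fun y => (#|Z|%:R * \sum_(y' | adj y y') v y' + l%:R * v y) ^+ 2)).
rewrite (sumE (fun y => v y ^+ 2)) mulrCA ler_pM2l //.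
rewrite PoszD PoszM -!natz; apply=> s sadj.
rewrite (eq_bigr (fun w : Y * Z => (v w.1)%:~R * s (w.1, w.2))) => [|[]//].
rewrite -(pair_bigA _ (fun y z => (v y)%:~R * s (y, z))) /=.
under eq_bigr do rewrite -mulr_sumr.
apply: (orth (fun y z => s (y, z))) => [y z y' z' yy|y z z' zz]; apply: sadj.
  exact: lex_adjl.
exact: lex_adjr.
Qed.
End Lex.

Lemma complement_adjE (G : sgraph) (x y : G) :
  @adj (complement G) x y = (x != y) && ~~ adj x y.
Proof. by []. Qed.

Lemma connected_neighbour (G : sgraph) (x : G) :
  connected G -> (1 < #|G|)%N -> exists y, adj x y.
Proof.
move=> cG n2; have : (0 < #|[set~ x]|)%N by rewrite cardsC1; lia.
case/card_gt0P=> y; rewrite !inE => yx.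
have /connectP[[|a p] /=] := cG x y; first by move=> _ e; rewrite e eqxx in yx.
by case/andP=> xa _ _; exists a.
Qed.

Lemma regular1_matching (G : sgraph) :
  regular_of 1 G -> exists m : G -> G, forall x y, adj x y = (y == m x).
Proof.
move=> G1; have ex (x : G) : exists y, [set z | adj x z] == [set y].
  have /cards1P[y ->] : #|[set z | adj x z]| == 1%N by rewrite G1.
  by exists y.
exists (fun x => xchoose (ex x)) => x y.
by have /eqP/setP/(_ y) := xchooseP (ex x); rewrite !inE.
Qed.

Lemma regular0_adj (G : sgraph) (x y : G) : regular_of 0 G -> adj x y = false.
Proof.
move=> /(_ x)/eqP; rewrite cards_eq0 => /eqP/setP/(_ y).
by rewrite !inE.
Qed.

(** * Necessary conditions for complete fibres *)

Section RamanujanComplete.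
Variables (C : numClosedFieldType) (q : nat) (Y : sgraph) (k : nat).
Hypothesis q3 : (3 <= q)%N.
Hypothesis nY : #|Y| = (q - 1)%N.
Hypothesis cY : connected Y.
Hypothesis kY : regular_of k Y.

Lemma lex_base_vertex : exists x : Y, true.
Proof.
have : (0 < #|Y|)%N by rewrite nY; lia.
by case/card_gt0P=> x _; exists x.
Qed.

Lemma lex_degree_bounds : (0 < k)%N /\ (k + 2 <= q)%N.
Proof.
have [x _] := lex_base_vertex.
have [|y xy] := connected_neighbour x cY; first by lia.
split; first by rewrite -(kY x); apply/card_gt0P; exists y; rewrite inE.
have : (#|[set y | adj x y]| <= #|[set~ x]|)%N.
  apply/subset_leq_card/subsetP => z; rewrite !inE => /adj_neq.
  by rewrite eq_sym.
by rewrite (kY x) cardsC1; lia.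
Qed.

Let j := (#|Y| - k.+1)%N.

Lemma ramanujan_lex_complete :
  ramanujan C (lex_product Y (complete_graph q)) ->
  (forall x y : Y, adj x y = (x != y)) \/
  (exists m : Y -> Y, forall x y : Y, ((x != y) && ~~ adj x y) = (y == m x)).
Proof.
move=> ram; have [k0 kq] := lex_degree_bounds; have [x0 _] := lex_base_vertex.
have cardZ : #|complete_graph q| = q by rewrite card_ord.
have z0 : complete_graph q by exists 0%N; lia.
have jH : regular_of j (complement Y) := complement_regular kY.
have jE : j%:R = q%:R - 2 - k%:R :> int by rewrite /j nY; lia.
have qp : q.-1%:R = q%:R - 1 :> int by lia.
have Hb (v : complement Y -> int) : \sum_x v x = 0 ->
   \sum_x (q%:R * \sum_(y | adj x y) v y + 1 * v x) ^+ 2 <=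
     4 * (q%:R * (q%:R - 1 - j%:R) - 2) * \sum_x v x ^+ 2.
  move=> v0.
  have := lex_norm_bound x0 z0 ram kY (@complete_regular q) v0.
  rewrite cardZ.
  have -> : 4 * (q%:R * k%:R + q.-1%:R - 1) = 4 * (q%:R * (q%:R - 1 - j%:R) - 2) :> int.
    by rewrite jE qp; ring.
  rewrite (eq_bigr (fun x => (q%:R * \sum_(y | @adj (complement Y) x y) v y + 1 * v x) ^+ 2)).
    (* A function changing sign along every edge of the fibre vanishes: around a triangle z, a, b it
       satisfies s z = - s z. Here q >= 3 is used. *)
    apply=> s _ sZ; apply: big1 => y _; rewrite [X in _ * X]big1 ?mulr0 // => z _.
    have [a az] : exists a : 'I_q, a != z.
      have : (0 < #|[set~ z]|)%N by rewrite cardsC1 card_ord; lia.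
      by case/card_gt0P=> a; rewrite !inE => az; exists a.
    have [b /andP[bz ba]] : exists b : 'I_q, (b != z) && (b != a).
      have : (0 < #|~: [set z; a]|)%N.
        by have := cardsC [set z; a]; rewrite cards2 card_ord eq_sym az; lia.
      by case/card_gt0P=> b; rewrite !inE negb_or => ba; exists b.
    have e1 := sZ y z a; have e2 := sZ y a b; have e3 := sZ y b z.
    have : s y z = - s y z.
      rewrite {1}e1 ?e2 ?e3 ?opprK //; first by rewrite /adj /= /complete_adj eq_sym.
      by rewrite /adj /= /complete_adj eq_sym.
    by move/eqP; rewrite -addr_eq0 -mulr2n mulrn_eq0 => /eqP.
  (* On vectors of sum zero, q A + (q - 1) equals -(q H + 1); the square hides the sign. *)
  move=> y _; rewrite (@sum_complement Y v y v0) qp.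
  by rewrite -sqrrN; congr (_ ^+ 2); ring.
have qE : q%:R = #|complement Y|%:R + 1 :> int by rewrite nY; lia.
have q3' : 3 <= q%:R :> int by lia.
have k1' : 1 <= q%:R - 2 - j%:R :> int by rewrite jE; lia.
have := norm_bound_vertex jH Hb x0.
rewrite [#|_|%:R](_ : _ = q%:R - 1); last by rewrite qE addrK.
move=> /(complete_vertex_arith q3' (ler0n _ _) k1')[j3 j39].
have : [|| j == 0, j == 1, j == 2 | j == 3]%N by lia.
case/or4P=> /eqP je.
- left=> x y; rewrite je in jH; have := @regular0_adj (complement Y) x y jH.
  rewrite complement_adjE; case: eqP => [->|_] /=; first by rewrite adj_irr.
  by move/negbFE.
- right; rewrite je in jH; exact: regular1_matching jH.
- exfalso; rewrite je in jH Hb; apply: (@regular2_complement (complement Y) _ x0 jH qE _ Hb).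
  by rewrite je in k1'; lia.
- exfalso; rewrite je in jH Hb; apply: (@cubic_complement (complement Y) _ x0 jH qE _ Hb).
  by apply: j39; rewrite je.
Qed.
End RamanujanComplete.

(** * Necessary conditions for edgeless fibres *)

Lemma bipartite_arith (r k : int) : 1 <= k -> k <= r ->
  (2 * r + 1) ^+ 2 * (k * (r - k)) <= 4 * ((2 * r + 1) * k - 1) * (r - 1) ->
  k = r \/ k = r - 1 /\ 3 <= r.
Proof.
move=> k1 kr le.
have [->|[kE|kr2]] : k = r \/ k = r - 1 \/ k <= r - 2 by lia.
- by left.
(* For k = r - 1, the value r = 1 contradicts k >= 1, and r = 2 would give 25 <= 16. With q = 2 r +
   1, r >= 3 becomes q >= 7. *)
- subst k; right; split=> //; rewrite leNgt; apply/negP => r3.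
  have [?|?] : r = 1 \/ r = 2 by lia.
    by subst r; lia.
  by subst r; lia.
exfalso; have h : 0 <= (2 * r + 1) * k by nia.
have : (2 * r + 1) * k * ((2 * r + 1) * (r - k) - 4 * (r - 1)) <= - 4 * (r - 1) by lia.
have h2 : 0 <= (2 * r + 1) * (r - k) - 4 * (r - 1) by nia.
have := mulr_ge0 h h2; lia.
Qed.

Lemma antisymmetric_sqr (R : comNzRingType) (G : sgraph) (w : G -> R) (x y : G) :
  connected G -> (forall x y, adj x y -> w x = - w y) -> w x ^+ 2 = w y ^+ 2.
Proof.
move=> cG wN; apply: (connected_const (f := fun x => w x ^+ 2)) => // a b ab.
by rewrite (wN a b ab) sqrrN.
Qed.

(** The square of [w] is constant by connectedness, so [w] takes the two values w x and - w x, and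
    these are the two colours. *)
Lemma antisymmetric_bipartite (C : numClosedFieldType) (G : sgraph) (w : G -> C) (x : G) :
  connected G -> (forall x y, adj x y -> w x = - w y) -> w x != 0 ->
  exists c : G -> bool, forall x y, adj x y -> c x != c y.
Proof.
move=> cG wN wx; exists (fun y => w y == w x) => a b ab.
have pm : w b = w x \/ w b = - w x.
  have /eqP := antisymmetric_sqr b x cG wN.
  by rewrite eqf_sqr => /orP[]/eqP; [left|right].
have neg : (- w x == w x) = false.
  by rewrite eq_sym -addr_eq0 -mulr2n mulrn_eq0 (negPf wx).
by rewrite (wN a b ab); case: pm => ->; rewrite ?opprK eqxx neg.
Qed.

Section Bipartite.
Variables (G : sgraph) (c : G -> bool) (k : nat).
Hypothesis kG : regular_of k G.
Hypothesis cN : forall x y, adj x y -> c x != c y.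

(** Both sides, multiplied by [k], count the edges by their end in one colour class. *)
Lemma bipartite_balanced :
  (0 < k)%N -> #|[set x | c x]| = #|[set x | ~~ c x]|.
Proof.
move=> k0; apply/eqP; rewrite -(eqn_pmul2l k0) -(eqr_nat int) !natrM; apply/eqP.
have cardE (p : pred G) : #|[set x | p x]|%:R = \sum_x (p x)%:R :> int.
  by rewrite -sum1_card natr_sum big_mkcond; apply: eq_bigr => x _; rewrite inE; case: (p x).
rewrite !cardE !mulr_sumr.
transitivity (\sum_x \sum_(y | adj x y) (c x)%:R : int).
  by apply: eq_bigr => x _; rewrite (sum_adj_const _ _ kG).
rewrite sum_adj_exchange; apply: eq_bigr => x _.
rewrite -(sum_adj_const x _ kG); apply: eq_bigr => y /cN.
by case: (c x); case: (c y).
Qed.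

Lemma bipartite_compl_sym : symmetric (fun x y : G => (c x != c y) && ~~ adj x y).
Proof. by move=> x y; rewrite eq_sym adj_sym. Qed.
Lemma bipartite_compl_irr : irreflexive (fun x y : G => (c x != c y) && ~~ adj x y).
Proof. by move=> x; rewrite eqxx. Qed.
Definition bipartite_complement : sgraph :=
  SGraph bipartite_compl_sym bipartite_compl_irr.

Lemma bipartite_compl_adjE (x y : G) :
  @adj bipartite_complement x y = (c x != c y) && ~~ adj x y.
Proof. by []. Qed.

Lemma bipartite_part_card (x : G) : (0 < k)%N ->
  #|[set y | c y == c x]| = #|[set y | c y]| /\ #|[set y | c x != c y]| = #|[set y | c y]|.
Proof.
move=> k0; have bal := bipartite_balanced k0.
have part b : #|[set y | c y == b]| = #|[set y | c y]|.
  by case: b; [|rewrite bal]; apply: eq_card => y; rewrite !inE; case: (c y).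
split; first exact: part.
by rewrite -(part (~~ c x)); apply: eq_card => y; rewrite !inE; case: (c x); case: (c y).
Qed.

Lemma bipartite_degree_le (x : G) : (0 < k)%N -> (k <= #|[set y | c y]|)%N.
Proof.
move=> k0; rewrite -(bipartite_part_card x k0).2 -(kG x).
by apply/subset_leq_card/subsetP => y; rewrite !inE => /cN.
Qed.

Lemma bipartite_complement_regular : (0 < k)%N ->
  regular_of (#|[set x | c x]| - k) bipartite_complement.
Proof.
move=> k0 x; rewrite -(bipartite_part_card x k0).2 -(kG x).
have sub : [set y | @adj G x y] \subset [set y | c x != c y].
  by apply/subsetP => y; rewrite !inE => /cN.
rewrite -cardsDS //; apply: eq_card => y.
by rewrite !inE andbC.
Qed.
End Bipartite.

Section RamanujanEdgeless.
Variables (C : numClosedFieldType) (q : nat) (Y : sgraph) (k : nat).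
Hypothesis q3 : (3 <= q)%N.
Hypothesis nY : #|Y| = (q - 1)%N.
Hypothesis cY : connected Y.
Hypothesis kY : regular_of k Y.
Hypothesis ram : ramanujan C (lex_product Y (edgeless_graph q)).

Let j := (#|Y| - k.+1)%N.

(** An antisymmetric function on the product may vary along a fibre, but its fibre sums are
    antisymmetric on [Y], so orthogonality need be checked on [Y] alone. *)
Lemma ramanujan_lex_edgeless_bound (v : Y -> int) :
  \sum_x v x = 0 ->
  (forall w : Y -> C, (forall x y, adj x y -> w x = - w y) ->
     \sum_y (v y)%:~R * w y = 0) ->
  q%:R ^+ 2 * \sum_x (\sum_(y | adj x y) v y) ^+ 2 <=
    4 * (q%:R * k%:R - 1) * \sum_x v x ^+ 2.
Proof.
move=> v0 orth; have [x0 _] := lex_base_vertex q3 nY.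
have cardZ : #|edgeless_graph q| = q by rewrite card_ord.
have z0 : edgeless_graph q by exists 0%N; lia.
have := lex_norm_bound x0 z0 ram kY (@edgeless_regular q) v0.
rewrite cardZ addr0 mulr_sumr.
rewrite (eq_bigr (fun x => q%:R ^+ 2 * (\sum_(y | adj x y) v y) ^+ 2)); last first.
  by move=> x _; rewrite mul0r addr0 exprMn.
apply=> s sY _; apply: orth => x y xy.
by rewrite -sumrN; apply: eq_bigr => z _; apply: sY.
Qed.

(** Without a 2-colouring every antisymmetric function is zero, so each vector of sum zero is
    admissible and the complement has degree 0. *)
Lemma ramanujan_lex_edgeless_nonbipartite :
  ~ (exists c : Y -> bool, forall x y, adj x y -> c x != c y) ->
  forall x y : Y, adj x y = (x != y).
Proof.
move=> nbip; have [k0 kq] := lex_degree_bounds q3 nY cY kY.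
have [x0 _] := lex_base_vertex q3 nY.
have jH : regular_of j (complement Y) := complement_regular kY.
have jE : j%:R = q%:R - 2 - k%:R :> int by rewrite /j nY; lia.
have qE : q%:R = #|complement Y|%:R + 1 :> int by rewrite nY; lia.
have j0 : j = 0%N.
  apply: (@edgeless_complement (complement Y) j q%:R x0) => //; [lia|rewrite jE; lia|].
  move=> v v0; rewrite (_ : q%:R * (q%:R - 2 - j%:R) = q%:R * k%:R); last by rewrite jE; ring.
  have -> : \sum_(x : complement Y) (q%:R * \sum_(y | adj x y) v y + q%:R * v x) ^+ 2 =
      q%:R ^+ 2 * \sum_(x : Y) (\sum_(y | adj x y) v y) ^+ 2.
    rewrite mulr_sumr; apply: eq_bigr => x _.
    by rewrite (@sum_complement Y v x v0) sqrrN -exprMn mulrDr addrC.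
  apply: ramanujan_lex_edgeless_bound => // w wN; apply: big1 => y _.
  case: (eqVneq (w y) 0) => [->|wy]; first by rewrite mulr0.
  by case: nbip; apply: antisymmetric_bipartite wN wy.
move=> x y; rewrite j0 in jH; have := @regular0_adj (complement Y) x y jH.
rewrite complement_adjE; case: eqP => [->|_] /=; first by rewrite adj_irr.
by move/negbFE.
Qed.

Lemma ramanujan_lex_edgeless_bipartite (c : Y -> bool) :
  (forall x y, adj x y -> c x != c y) ->
  #|[set x | c x]| = #|[set x | ~~ c x]| /\
  ((forall x y : Y, adj x y = (c x != c y)) \/
   (7 <= q)%N /\ exists m : Y -> Y,
     forall x y : Y, ((c x != c y) && ~~ adj x y) = (y == m x)).
Proof.
move=> cN; have [k0 kq] := lex_degree_bounds q3 nY cY kY.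
have [x _] := lex_base_vertex q3 nY.
have bal := bipartite_balanced kY cN k0; split=> //.
have H2 := bipartite_complement_regular kY cN k0.
have kr := bipartite_degree_le kY cN x k0.
have [part _] := bipartite_part_card kY cN x k0.
have card2 : (2 * #|[set x | c x]| = q - 1)%N.
  rewrite mul2n -addnn {2}bal -nY -(cardsC [set x | c x]); congr (_ + _)%N.
  by apply: eq_card => y; rewrite !inE.
move: kr part card2 H2; set r := #|[set x | c x]| => kr part card2 H2.
pose e y : int := (c y == c x)%:R.
pose v y : int := r%:R * (y == x)%:R - e y.
have se : \sum_y e y = r%:R.
  by rewrite -part -sum1_card natr_sum [RHS]big_mkcond; apply: eq_bigr => y _; rewrite inE /e; case: eqP.
have v0 : \sum_y v y = 0.
  by rewrite sumrB -mulr_sumr sum_delta1 mulr1 se subrr.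
have Av y : \sum_(z | adj y z) v z = r%:R * (adj y x)%:R - k%:R * (1 - e y).
  rewrite sumrB -mulr_sumr sum_delta1 -(sum_adj_const y _ kY); congr (_ - _).
  apply: eq_bigr => z /cN; rewrite /e.
  by case: (c x); case: (c y); case: (c z).
have sa : \sum_y (adj y x)%:R = k%:R :> int.
  rewrite -[RHS]mulr1 -(sum_adj_const x 1 kY) [RHS]big_mkcond /=.
  by apply: eq_bigr => y _; rewrite adj_sym; case: adj.
have := ramanujan_lex_edgeless_bound v0.
have -> : \sum_y v y ^+ 2 = r%:R * (r%:R - 1).
  have -> : \sum_y v y ^+ 2 = \sum_y ((r%:R ^+ 2 - 2 * r%:R) * (y == x)%:R + e y).
    apply: eq_bigr => y _; rewrite /v /e; have [->|_] := eqVneq y x.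
      by rewrite eqxx /=; ring.
    by case: eqP => /= _; ring.
  by rewrite big_split /= -mulr_sumr sum_delta1 se /=; ring.
have -> : \sum_y (\sum_(z | adj y z) v z) ^+ 2 = r%:R * (k%:R * (r%:R - k%:R)).
  have -> : \sum_y (\sum_(z | adj y z) v z) ^+ 2 =
    \sum_y ((r%:R ^+ 2 - 2 * r%:R * k%:R) * (adj y x)%:R + k%:R ^+ 2 * (1 - e y)).
    apply: eq_bigr => y _; rewrite Av /e; case yx : (adj y x).
      by rewrite (negPf (cN _ _ yx)) /=; ring.
    by case: eqP => /= _; ring.
  rewrite big_split /= -!mulr_sumr sa sumrB se sum_const_card nY.
  by rewrite (_ : (q - 1)%:R = 2 * r%:R); [ring|lia].
have qE : q%:R = 2 * r%:R + 1 :> int by lia.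
have r0 : 0 < r%:R :> int by lia.
rewrite [X in _ -> X <= _]mulrCA [X in _ -> _ <= X]mulrCA ler_pM2l // qE.
move=> le; have [|||kE|[kE r3]] := @bipartite_arith r%:R k%:R; try lia.
- apply: le => w wN.
  (* An antisymmetric [w] is constant on the part of [x], which carries [v]; hence its pairing with
     [v] is a multiple of the sum of [v]. *)
  have wc y : w y = (-1) ^+ (c y != c x) * w x.
    have := connected_const (f := fun y => (-1) ^+ (c y != c x) * w y) cY _ y x.
    rewrite eqxx expr0 mul1r => <-; first by rewrite mulrA -expr2 sqrr_sign mul1r.
    move=> a b ab; rewrite (wN a b ab); have := cN a b ab.
    by case: (c a); case: (c b); case: (c x) => //= _; rewrite !(expr0, expr1, mul1r, mulN1r, opprK).
  rewrite (eq_bigr (fun y => (v y)%:~R * w x)) => [|y _].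
    by rewrite -mulr_suml -(rmorph_sum intr) v0 mul0r.
  rewrite wc /v /e; case: (eqVneq y x) => [->|_]; first by rewrite eqxx mul1r.
  by case: (c y == c x); rewrite /= ?mul1r // mulr0 subrr !mul0r.
- left=> a b; have rk : (r - k = 0)%N by lia.
  rewrite rk in H2; have := @regular0_adj (bipartite_complement c) a b H2.
  rewrite bipartite_compl_adjE; have := cN a b.
  by case: (adj a b) => [->//|_]; rewrite andbT => ->.
right; split; first by lia.
have rk : (r - k = 1)%N by lia.
by rewrite rk in H2; apply: regular1_matching H2.
Qed.
End RamanujanEdgeless.

(** The Ramanujan bound squared, as an inequality of natural numbers. *)
Lemma natr_le_2sqrt (C : numClosedFieldType) (x d : nat) :
  (x ^ 2 + 4 <= 4 * d)%N -> x%:R <= 2 * sqrtC (d%:R - 1) :> C.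
Proof.
move=> le; have d1 : 0 <= d%:R - 1 :> C by rewrite subr_ge0 ler1n; lia.
rewrite -ler_sqr ?nnegrE ?ler0n ?mulr_ge0 ?ler0n ?sqrtC_ge0 //.
rewrite exprMn sqrtCK mulrBr mulr1 lerBrDr -natrX -natrX -natrM -natrD ler_nat.
by move: le; lia.
Qed.

Lemma norm_sqr_natr (C : numClosedFieldType) (a : C) (n : nat) :
  a ^+ 2 = n%:R ^+ 2 -> `|a| = n%:R.
Proof.
move=> e; apply/eqP; rewrite -(@eqrXn2 _ 2) ?normr_ge0 ?ler0n //.
by rewrite -normrX e normrX normr_nat.
Qed.

Lemma matching_involutive (T : finType) (R : rel T) (m : T -> T) :
  symmetric R -> (forall x y, R x y = (y == m x)) -> involutive m.
Proof. by move=> Rsym Rm x; apply/esym/eqP; rewrite -Rm Rsym Rm. Qed.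

(** * Spectra of the listed products *)

Section LexSpectrum.
Variables (C : numClosedFieldType) (q : nat) (Y : sgraph) (k : nat).
Hypothesis q3 : (3 <= q)%N.
Hypothesis nY : #|Y| = (q - 1)%N.
Hypothesis cY : connected Y.
Hypothesis kY : regular_of k Y.

Definition small_for (d : nat) (a : C) :=
  `|a| = d%:R \/ exists2 x : nat, `|a| <= x%:R & (x ^ 2 + 4 <= 4 * d)%N.

Lemma small_ramanujan (G : sgraph) (d : nat) :
  connected G -> regular_of d G ->
  (forall (a : C) (w : G -> C), (exists x, w x != 0) ->
     (forall x, \sum_(y | adj x y) w y = a * w x) -> small_for d a) ->
  ramanujan C G.
Proof.
move=> cG dG H; split=> //; exists d => // a /eigenvalue_adjP[w w0 wA] aN.
case: (H a w w0 wA) => [e|[x le xd]]; first by rewrite e eqxx in aN.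
by apply: le_trans le _; apply: natr_le_2sqrt.
Qed.

Lemma lex_neighbour (y : Y) : exists y', adj y y'.
Proof. by apply: connected_neighbour cY _; rewrite nY; lia. Qed.

(** The fibre sums [W] of an eigenfunction satisfy q A_Y W = a W. If they all vanish, the eigenvalue
    equation forces a = 0. *)
Lemma ramanujan_lex_edgelessI :
  (forall (a : C) (W : Y -> C), (exists y, W y != 0) ->
     (forall y, q%:R * \sum_(y' | adj y y') W y' = a * W y) ->
     small_for (q * k) a) ->
  ramanujan C (lex_product Y (edgeless_graph q)).
Proof.
move=> H; have [k0 kq] := lex_degree_bounds q3 nY cY kY.
have dG := lex_regular kY (@edgeless_regular q).
rewrite card_ord addn0 in dG.
apply: small_ramanujan dG _; first exact: lex_connected cY lex_neighbour.
move=> a w [[y0 z0] w0] wA.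
pose W y := \sum_z w (y, z).
have WA y z : \sum_(y' | adj y y') W y' = a * w (y, z).
  by rewrite -wA sum_lex /= [X in _ + X]big_pred0 // addr0.
have [/existsP[y Wy]|W0] := boolP [exists y, W y != 0].
  apply: (H a W); first by exists y.
  move=> y'; rewrite /W [RHS]mulr_sumr -(eq_bigr _ (fun z _ => WA y' z)).
  by rewrite sumr_const card_ord mulr_natl.
right; exists 0%N; last by nia.
have /eqP := WA y0 z0; rewrite big1 => [|y _].
  by rewrite eq_sym mulf_eq0 (negPf w0) orbF => /eqP ->; rewrite normr0.
by move/existsPn: W0 => /(_ y); rewrite negbK => /eqP.
Qed.

(** As for edgeless fibres, but the fibre contributes W y - w (y, z), whence the shift by 1;
    vanishing fibre sums now force a = -1. *)
Lemma ramanujan_lex_completeI :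
  (forall (a : C) (W : Y -> C), (exists y, W y != 0) ->
     (forall y, q%:R * (\sum_(y' | adj y y') W y' + W y) = (a + 1) * W y) ->
     small_for (q * k + q.-1) a) ->
  ramanujan C (lex_product Y (complete_graph q)).
Proof.
move=> H; have [k0 kq] := lex_degree_bounds q3 nY cY kY.
have dG := lex_regular kY (@complete_regular q).
rewrite card_ord in dG.
apply: small_ramanujan dG _; first exact: lex_connected cY lex_neighbour.
move=> a w [[y0 z0] w0] wA.
pose W y := \sum_z w (y, z).
have WA y z : \sum_(y' | adj y y') W y' + W y = (a + 1) * w (y, z).
  rewrite mulrDl mul1r -wA sum_lex /= -addrA; congr (_ + _).
  rewrite /W (bigD1 z) //= addrC; congr (_ + _).
  by apply: eq_bigl => z'; rewrite eq_sym.
have [/existsP[y Wy]|W0] := boolP [exists y, W y != 0].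
  apply: (H a W); first by exists y.
  move=> y'; rewrite /W [RHS]mulr_sumr -(eq_bigr _ (fun z _ => WA y' z)).
  by rewrite sumr_const card_ord mulr_natl.
right; exists 1%N; last by nia.
have Wz y : W y = 0 by move/existsPn: W0 => /(_ y); rewrite negbK => /eqP.
have /eqP := WA y0 z0; rewrite Wz big1 // addr0.
rewrite eq_sym mulf_eq0 (negPf w0) orbF addr_eq0 => /eqP ->.
by rewrite normrN normr1.
Qed.

Lemma complete_sum (W : Y -> C) (y : Y) : (forall x y : Y, adj x y = (x != y)) ->
  \sum_(y' | adj y y') W y' = \sum_x W x - W y.
Proof.
move=> aY; rewrite [\sum_x W x](bigD1 y) //= addrAC subrr add0r.
by apply: eq_bigl => z; rewrite aY eq_sym.
Qed.

Lemma regular_degree (x : Y) : k%:R = \sum_(y | adj x y) 1 :> C.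
Proof. by rewrite (sum_adj_const _ _ kY) mulr1. Qed.

Lemma complete_degree : (forall x y : Y, adj x y = (x != y)) -> k = (q - 2)%N.
Proof.
move=> aY; have [x _] := lex_base_vertex q3 nY.
apply/eqP; rewrite -(eqr_nat C) (regular_degree x) complete_sum //.
rewrite sumr_const nY (_ : (q - 1)%N = (q - 2).+1); last by lia.
by rewrite -natr1 addrK.
Qed.

Lemma complete_lex_edgeless : (forall x y : Y, adj x y = (x != y)) ->
  ramanujan C (lex_product Y (edgeless_graph q)).
Proof.
move=> aY; have kE := complete_degree aY.
apply: ramanujan_lex_edgelessI => a W [y Wy] WA.
set S := \sum_x W x.
have WA' x : (a + q%:R) * W x = q%:R * S.
  by rewrite mulrDl -WA complete_sum // -/S; ring.
have [aq|aq] := eqVneq (a + q%:R) 0.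
  have -> : a = - q%:R by apply/eqP; rewrite -addr_eq0 aq.
  (* For q = 3 the bound would be 13 <= 12, but then -q = -d is trivial; from q = 4 on, q^2 + 4 <= 4
     q (q - 2). *)
  rewrite /small_for normrN normr_nat; have [qE|qN] := eqVneq q 3%N.
    by left; rewrite kE qE.
  by right; exists q => //; rewrite kE; nia.
have Wc x : W x = W y by apply: (mulfI aq); rewrite !WA'.
have SE : S = (q - 1)%:R * W y.
  by rewrite /S (eq_bigr _ (fun x _ => Wc x)) sumr_const nY mulr_natl.
left; have : a + q%:R = (q * (q - 1))%:R.
  by apply: (mulIf Wy); rewrite WA' SE natrM mulrA.
move/esym/eqP; rewrite -subr_eq -natrB => [/eqP <-|]; last by nia.
by rewrite normr_nat kE; congr (_%:R); nia.
Qed.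

Lemma complete_lex_complete : (forall x y : Y, adj x y = (x != y)) ->
  ramanujan C (lex_product Y (complete_graph q)).
Proof.
move=> aY; have kE := complete_degree aY.
apply: ramanujan_lex_completeI => a W [y Wy] WA.
set S := \sum_x W x.
have WA' x : (a + 1) * W x = q%:R * S by rewrite -WA complete_sum // subrK.
have [aq|aq] := eqVneq (a + 1) 0.
  have -> : a = - 1 by apply/eqP; rewrite -addr_eq0 aq.
  right; exists 1%N; first by rewrite normrN normr1.
  by nia.
have Wc x : W x = W y by apply: (mulfI aq); rewrite !WA'.
have SE : S = (q - 1)%:R * W y.
  by rewrite /S (eq_bigr _ (fun x _ => Wc x)) sumr_const nY mulr_natl.
left; have : a + 1%:R = (q * (q - 1))%:R.
  by apply: (mulIf Wy); rewrite WA' SE natrM mulrA.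
move/esym/eqP; rewrite -subr_eq -natrB => [/eqP <-|]; last by nia.
by rewrite normr_nat kE; congr (_%:R); nia.
Qed.

(** The fibre sums satisfy (a + 1) W = q (S - W o m), with S their total. If S is nonzero, summation
    gives a = d; otherwise two applications give (a + 1)^2 = q^2. *)
Lemma cocktail_lex_complete (m : Y -> Y) : (5 <= q)%N ->
  (forall x y : Y, ((x != y) && ~~ adj x y) = (y == m x)) ->
  ramanujan C (lex_product Y (complete_graph q)).
Proof.
move=> q5 mY.
have mK : involutive m.
  by apply: (matching_involutive (R := @adj (complement Y))) => //; apply: adj_sym.
have sumE (W : Y -> C) y : \sum_(y' | adj y y') W y' + W y = \sum_x W x - W (m y).
  rewrite (sum_split_adj W y).
  have -> : \sum_(z | @adj (complement Y) y z) W z = W (m y).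
    by apply: big_pred1 => z; rewrite complement_adjE mY.
  by ring.
have kE : k = (q - 3)%N.
  have [x _] := lex_base_vertex q3 nY.
  apply/eqP; rewrite -(eqr_nat C) (regular_degree x) -(inj_eq (addIr 1)).
  rewrite (sumE (fun=> 1)) sumr_const nY (_ : (q - 1)%N = (q - 3).+2); last by lia.
  by rewrite -natr1 addrK natr1.
apply: ramanujan_lex_completeI => a W [y Wy] WA.
set S := \sum_x W x.
have WA' x : (a + 1) * W x = q%:R * (S - W (m x)) by rewrite -WA sumE.
have sm : \sum_x W (m x) = S by rewrite [RHS](reindex_inj (inv_inj mK)).
have SA : (a + 1) * S = q%:R * ((q - 2)%:R * S).
  rewrite {1}/S mulr_sumr (eq_bigr _ (fun x _ => WA' x)) -mulr_sumr sumrB.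
  rewrite sm sumr_const nY -[S *+ _]mulr_natl.
  rewrite (_ : (q - 1)%:R = (q - 2)%:R + 1); first by ring.
  by rewrite natr1; congr (_%:R); lia.
have [S0|SN] := eqVneq S 0; last first.
  left; have : a + 1%:R = (q * (q - 2))%:R by apply: (mulIf SN); rewrite SA natrM mulrA.
  move/esym/eqP; rewrite -subr_eq -natrB => [/eqP <-|]; last by nia.
  by rewrite normr_nat kE; congr (_%:R); nia.
(* With d = q^2 - 2 q - 1 the condition is (q + 1)^2 + 4 <= 4 d, which holds from q = 5 on. *)
right; exists q.+1; last by rewrite kE; nia.
have a1 : `|a + 1| = q%:R.
  apply: norm_sqr_natr; apply: (mulIf Wy); rewrite expr2 -mulrA WA' S0 sub0r.
  by rewrite mulrCA mulrN WA' S0 sub0r mK; ring.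
rewrite -[a](addrK 1); apply: le_trans (ler_normB _ _) _.
by rewrite a1 normr1 natr1.
Qed.

Section BipartiteCase.
Variables (c : Y -> bool) (r : nat).
Hypothesis qr : (q - 1 = 2 * r)%N.
Hypothesis card_part : forall b, #|[set y | c y == b]| = r.

Let part_sum (W : Y -> C) (b : bool) := \sum_(y | c y == b) W y.

Lemma sum_part_const (x : C) b : \sum_(y | c y == b) x = r%:R * x.
Proof.
rewrite sumr_const -(card_part b) mulr_natl; congr (_ *+ _).
by apply: eq_card => y; rewrite inE.
Qed.

Lemma part_sum_sqr (W : Y -> C) (a p : C) (b : bool) :
  (forall b, p * part_sum W (~~ b) = a * part_sum W b) -> part_sum W b != 0 ->
  a ^+ 2 = p ^+ 2.
Proof.
move=> H b0; apply: (mulIf b0); rewrite !expr2 -!mulrA -H.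
by rewrite mulrCA -H negbK.
Qed.

Lemma bipartite_lex_edgeless : (forall x y : Y, adj x y = (c x != c y)) ->
  ramanujan C (lex_product Y (edgeless_graph q)).
Proof.
move=> aY; have sumE (W : Y -> C) y : \sum_(y' | adj y y') W y' = part_sum W (~~ c y).
  by apply: eq_bigl => z; rewrite aY; case: (c y); case: (c z).
have kE : k = r.
  have [x _] := lex_base_vertex q3 nY.
  by apply/eqP; rewrite -(eqr_nat C) (regular_degree x) (sumE (fun=> 1)) /part_sum sum_part_const mulr1.
apply: ramanujan_lex_edgelessI => a W [y Wy] WA.
have TA b : (q * r)%:R * part_sum W (~~ b) = a * part_sum W b.
  rewrite [in RHS]/part_sum [RHS]mulr_sumr.
  rewrite [RHS](eq_bigr (fun=> q%:R * part_sum W (~~ b))) => [|x /eqP <-].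
    by rewrite sum_part_const natrM; ring.
  by rewrite -WA sumE.
have [T0|TN] := eqVneq (part_sum W (~~ c y)) 0; last first.
  by left; rewrite kE; apply: norm_sqr_natr; apply: part_sum_sqr TA TN.
right; exists 0%N; last by rewrite kE; nia.
have /eqP := WA y; rewrite sumE T0 mulr0 eq_sym mulf_eq0 (negPf Wy) orbF => /eqP ->.
by rewrite normr0.
Qed.

(** The part sums are exchanged up to the factor q k, so a nonzero one gives |a| = d. If both
    vanish, a W = - q (W o m), and a^2 = q^2 as [m] is an involution. *)
Lemma bipartite_matching_lex_edgeless (m : Y -> Y) : (7 <= q)%N ->
  (forall x y, adj x y -> c x != c y) ->
  (forall x y : Y, ((c x != c y) && ~~ adj x y) = (y == m x)) ->
  ramanujan C (lex_product Y (edgeless_graph q)).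
Proof.
move=> q7 cN mY.
have mK : involutive m.
  by apply: (matching_involutive (R := @adj (bipartite_complement c))) => //; apply: adj_sym.
have cm x : c (m x) = ~~ c x.
  have := mY x (m x); rewrite eqxx => /andP[].
  by case: (c x); case: (c (m x)).
have sumE (W : Y -> C) y :
    \sum_(y' | adj y y') W y' = part_sum W (~~ c y) - W (m y).
  rewrite /part_sum [in RHS](bigD1 (m y)) /= ?cm // addrAC subrr add0r.
  apply: eq_bigl => z; rewrite -mY; have := cN y z.
  by case: (adj y z) => [/(_ isT)|_]; case: (c y); case: (c z).
have kE : k = (r - 1)%N.
  have [x _] := lex_base_vertex q3 nY.
  apply/eqP; rewrite -(eqr_nat C) (regular_degree x) (sumE (fun=> 1)) /part_sum sum_part_const mulr1.
  by rewrite natrB //; lia.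
apply: ramanujan_lex_edgelessI => a W [y Wy] WA.
have sm b : \sum_(x | c x == b) W (m x) = part_sum W (~~ b).
  rewrite /part_sum [RHS](reindex_inj (inv_inj mK)); apply: eq_bigl => x.
  by rewrite cm; case: (c x); case: b.
have TA b : (q * k)%:R * part_sum W (~~ b) = a * part_sum W b.
  rewrite [in RHS]/part_sum [RHS]mulr_sumr.
  rewrite [RHS](eq_bigr (fun x => q%:R * part_sum W (~~ b) - q%:R * W (m x))) => [|x /eqP <-].
    rewrite sumrB sum_part_const -mulr_sumr sm.
    by rewrite kE natrM natrB; [ring|lia].
  by rewrite -WA sumE mulrBr.
have [/existsP[b Tb]|T0] := boolP [exists b, part_sum W b != 0].
  by left; apply: norm_sqr_natr; apply: part_sum_sqr TA Tb.
have Tz b : part_sum W b = 0 by move/existsPn: T0 => /(_ b); rewrite negbK => /eqP.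
have WA' x : a * W x = - (q%:R * W (m x)) by rewrite -WA sumE Tz sub0r mulrN.
(* Since k = (q - 3) / 2, the condition is q^2 + 4 <= 2 q (q - 3): true from q = 7 on, false at q =
   5. *)
right; exists q; last by rewrite kE; nia.
rewrite (@norm_sqr_natr _ a q) //; apply: (mulIf Wy).
by rewrite expr2 -mulrA WA' mulrN mulrCA WA' mK; ring.
Qed.
End BipartiteCase.
End LexSpectrum.

(** * Isomorphisms and perfect matchings *)

Lemma card_bijective (T U : finType) : #|T| = #|U| -> exists f : T -> U, bijective f.
Proof.
move=> e; exists (fun x => enum_val (cast_ord e (enum_rank x))).
exists (fun y => enum_val (cast_ord (esym e) (enum_rank y))) => x.
  by rewrite enum_valK cast_ordK enum_rankK.
by rewrite enum_valK cast_ordKV enum_rankK.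
Qed.

Lemma set2_inj (T : finType) (x y z : T) : [set x; y] = [set x; z] -> y = z.
Proof.
move=> /setP e; have := e y; have := e z; rewrite !inE !eqxx !orbT.
case: (eqVneq y x) => [->|_] /=; last by move=> _ /esym/eqP.
by rewrite orbb => /eqP.
Qed.

(** Each vertex lies in exactly one block of the partition, and that block is an edge; [m] sends the
    vertex to the other end. *)
Lemma perfect_matching_partner (G : sgraph) (M : {set {set G}}) :
  perfect_matching M -> exists m : G -> G, forall x y,
    ([set x; y] \in M) = (y == m x) /\ adj x (m x).
Proof.
move=> [/subsetP ME /and3P[/eqP cM tM _]].
have ex x : exists y, ([set x; y] \in M) && adj x y.
  have : x \in cover M by rewrite cM inE.
  case/bigcupP=> B BM; have := ME _ BM; rewrite inE.
  case/existsP=> a /existsP[b /andP[ab /eqP BE]]; rewrite BE !inE.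
  case/orP=> /eqP->; first by exists b; rewrite -BE BM.
  by exists a; rewrite setUC -BE BM adj_sym.
exists (fun x => xchoose (ex x)) => x y.
have /andP[mM xm] := xchooseP (ex x); split=> //.
set z := xchoose _ in mM xm *; apply/idP/eqP => [yM|->//].
apply: (@set2_inj _ x); apply: contraTeq isT => ne.
have := trivIsetP tM _ _ yM mM ne; rewrite disjoints_subset => /subsetP/(_ x).
by rewrite !inE eqxx => /(_ isT).
Qed.

Lemma card_perfect_matching (G : sgraph) (M : {set {set G}}) :
  perfect_matching M -> #|[set: G]| = (2 * #|M|)%N.
Proof.
move=> [/subsetP ME pM]; rewrite mulnC; apply: card_uniform_partition pM.
move=> e /ME; rewrite inE => /existsP[x /existsP[y /andP[xy /eqP->]]].
by rewrite cards2 (adj_neq xy).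
Qed.

(** The matching consists of the orbits of [m]. *)
Lemma involution_perfect_matching (G : sgraph) (m : G -> G) :
  involutive m -> (forall x, adj x (m x)) ->
  exists2 M : {set {set G}}, perfect_matching M &
    forall x y, ([set x; y] \in M) = (y == m x).
Proof.
move=> mK am; pose B x := [set x; m x].
have BE x z : z \in B x -> B x = B z.
  by rewrite !inE => /orP[]/eqP->; rewrite /B ?mK // setUC.
exists [set B x | x in G]; last first.
  move=> x y; apply/imsetP/eqP => [[z _ e]|->]; last by exists x.
  apply: (@set2_inj _ x); rewrite e -[RHS]/(B x) -(BE z x) //.
  by rewrite -e !inE eqxx.
split.
  apply/subsetP => _ /imsetP[x _ ->]; rewrite inE.
  by apply/existsP; exists x; apply/existsP; exists (m x); rewrite am /=.
apply/and3P; split.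
- rewrite eqEsubset subsetT; apply/subsetP => x _; apply/bigcupP.
  by exists (B x); rewrite ?imset_f // !inE eqxx.
- apply/trivIsetP => _ _ /imsetP[x _ ->] /imsetP[y _ ->]; apply: contraNT.
  by case/pred0Pn=> z /andP[/= /BE-> /BE->].
apply/imsetP => -[x _ e]; have : x \in B x by rewrite !inE eqxx.
by rewrite -e inE.
Qed.

Lemma delete_edgesE (G : sgraph) (M : {set {set G}}) (x y : G) :
  @adj (delete_edges M) x y = adj x y && ([set x; y] \notin M).
Proof. by []. Qed.

(** Reduces deletion of a matching to a partner function on [Y] itself, transported along [f]; this
    serves both the complete and the complete bipartite host. *)
Lemma delete_matching_iso (G Y : sgraph) :
  (exists2 M : {set {set G}}, perfect_matching M & graph_iso Y (delete_edges M)) <->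
  exists f : Y -> G, [/\ bijective f, forall x y, adj x y -> adj (f x) (f y) &
    exists m : Y -> Y, forall x y, (adj (f x) (f y) && ~~ adj x y) = (y == m x)].
Proof.
split=> [[M pM [f fB fadj]]|[f [fB fadj [m mY]]]].
  have [m mM] := perfect_matching_partner pM.
  exists f; split=> //; first by move=> x y; rewrite -fadj delete_edgesE => /andP[].
  have [g fK gK] := fB; exists (fun x => g (m (f x))) => x y.
  rewrite -(can2_eq fK gK) -fadj delete_edgesE (mM _ _).1.
  rewrite negb_and negbK andb_orr andbN /=.
  by have [->|_] := eqVneq (f y) (m (f x)); rewrite ?andbF ?(mM _ (f x)).2.
have fI := bij_inj fB; have [g fK gK] := fB.
pose R (x y : Y) := adj (f x) (f y) && ~~ adj x y.
have mK : involutive m.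
  by apply: (matching_involutive (R := R)) => // x y; rewrite /R !(adj_sym _ x) adj_sym.
have adjm x : adj (f x) (f (m x)) by have := mY x (m x); rewrite eqxx => /andP[].
have [|u|M pM MY] := @involution_perfect_matching G (fun u => f (m (g u))).
- by move=> u; rewrite fK mK gK.
- by rewrite -{1}(gK u) adjm.
exists M => //; exists f => // x y.
rewrite delete_edgesE MY fK (inj_eq fI) -mY.
by have := fadj x y; case: (adj x y) => [->|_]; rewrite ?andbF //= andbT andbN.
Qed.

Lemma complete_graph_iso (Y : sgraph) (n : nat) : #|Y| = n ->
  graph_iso Y (complete_graph n) <-> forall x y : Y, adj x y = (x != y).
Proof.
move=> nY; split=> [[f fB fadj] x y|aY].
  by rewrite -fadj -(inj_eq (bij_inj fB)).
have [|f fB] := @card_bijective Y 'I_n; first by rewrite card_ord.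
by exists f => // x y; rewrite aY -(inj_eq (bij_inj fB)).
Qed.

Definition side (m n : nat) (u : 'I_m + 'I_n) : bool :=
  if u is inl _ then true else false.

Lemma complete_bipartiteE (m n : nat) (u v : complete_bipartite m n) :
  adj u v = (side u != side v).
Proof. by case: u v => [?|?] [?|?]. Qed.

Lemma card_side (r : nat) (b : bool) : #|[set u : 'I_r + 'I_r | side u == b]| = r.
Proof.
transitivity #|[set (if b then inl i else inr i : 'I_r + 'I_r) | i : 'I_r]|.
  apply: eq_card => u; rewrite inE; apply/eqP/imsetP => [|[i _ ->]]; last by case: b.
  by case: b u => -[] i //= _; exists i.
rewrite card_imset ?card_ord //.
by case: b => i k [].
Qed.

(** Each element is numbered by its position in the enumeration of its own colour class. *)
Lemma side_bijection (Y : finType) (r : nat) (c : Y -> bool) :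
  (forall b, #|[set y | c y == b]| = r) ->
  exists2 f : Y -> 'I_r + 'I_r, bijective f & forall y, side (f y) = c y.
Proof.
move=> cr.
have pf y : (index y (enum [set z | c z == c y]) < r)%N.
  by rewrite -[X in (_ < X)%N](cr (c y)) cardE index_mem mem_enum inE.
pose f y : 'I_r + 'I_r := if c y then inl (Ordinal (pf y)) else inr (Ordinal (pf y)).
have fc y : side (f y) = c y by rewrite /f; case: ifP => e //=; rewrite ?e.
have fv y : match f y with inl i => val i | inr i => val i end =
    index y (enum [set z | c z == c y]) by rewrite /f; case: ifP => e; rewrite /= ?e.
exists f => //; apply: inj_card_bij => [x y fxy|].
  have cxy : c x = c y by rewrite -!fc fxy.
  have ixy : index x (enum [set z | c z == c x]) = index y (enum [set z | c z == c y]).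
    by rewrite -!fv fxy.
  rewrite cxy in ixy.
  have xin : x \in enum [set z | c z == c y] by rewrite mem_enum inE cxy.
  by rewrite -(nth_index x xin) ixy nth_index // mem_enum inE.
rewrite card_sum card_ord -{1}(cr true) -(cr false) -cardsUI.
rewrite (_ : _ :&: _ = set0) ?cards0 ?addn0 ?max_card //.
by apply/setP => y; rewrite !inE; case: (c y).
Qed.

Lemma bijective_side_card (Y : finType) (r : nat) (f : Y -> 'I_r + 'I_r) (b : bool) :
  bijective f -> #|[set y | side (f y) == b]| = r.
Proof.
move=> fB; rewrite -[RHS](card_side r b).
rewrite -(on_card_preimset (f := f) (R := [set u | side u == b])).
  by apply: eq_card => y; rewrite !inE.
exact: onW_bij.
Qed.

Lemma complete_bipartite_iso (Y : sgraph) (r : nat) :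
  graph_iso Y (complete_bipartite r r) <->
  exists2 c : Y -> bool, (forall b, #|[set y | c y == b]| = r) &
    forall x y : Y, adj x y = (c x != c y).
Proof.
split=> [[f fB fadj]|[c cr cY]].
  exists (fun y => side (f y)) => [b|x y]; first exact: bijective_side_card.
  by rewrite -fadj complete_bipartiteE.
have [f fB fc] := side_bijection cr.
by exists f => // x y; rewrite complete_bipartiteE !fc cY.
Qed.

(* The two classifications up to isomorphism *)
Local Close Scope sesquilinear_scope.
Local Close Scope ring_scope.

Theorem theorem2p3 (C : numClosedFieldType) (q : nat) (hq : 3 <= q)
    (Y : sgraph) (hY : #|Y| = q - 1) (Yconn : connected Y) (Yreg : regular Y) :
  (ramanujan C (lex_product Y (edgeless_graph q)) <->
     [\/ graph_iso Y (complete_graph (q - 1)),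
         exists r : nat, q - 1 = 2 * r /\ graph_iso Y (complete_bipartite r r)
       | exists (r : nat) (M : {set {set complete_bipartite r r}}),
           [/\ q - 1 = 2 * r, 7 <= q, perfect_matching M
             & graph_iso Y (delete_edges M)]])
  /\
  (ramanujan C (lex_product Y (complete_graph q)) <->
     graph_iso Y (complete_graph (q - 1)) \/
     exists (r : nat) (M : {set {set complete_graph (2 * r)}}),
       [/\ q - 1 = 2 * r, 5 <= q, perfect_matching M
         & graph_iso Y (delete_edges M)]).
Proof.
have [k kY] := Yreg.
split; split.
(* Colourings range over a finite type, so bipartiteness is decidable and the case split is
   constructive. *)
- move=> ram; have [/existsP[c /'forall_forallP cN]|nbip] :=
    boolP [exists c : {ffun Y -> bool}, [forall x, forall y, adj x y ==> (c x != c y)]];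
    last first.
    constructor 1; apply/complete_graph_iso => //.
    apply: ramanujan_lex_edgeless_nonbipartite hq hY Yconn kY ram _ => -[c cN].
    case/existsP: nbip; exists (finfun c); apply/'forall_forallP => x y.
    by rewrite !ffunE; apply/implyP => /cN.
  have {}cN x y : adj x y -> c x != c y := implyP (cN x y).
  have [bal res] := ramanujan_lex_edgeless_bipartite hq hY Yconn kY ram cN.
  pose r := #|[set x | c x]|.
  have cr b : #|[set y | c y == b]| = r.
    by case: b; [|rewrite /r bal]; apply: eq_card => y; rewrite !inE; case: (c y).
  have qr : q - 1 = 2 * r.
    rewrite -hY -(cardsC [set x | c x]) mul2n -addnn; congr (_ + _).
    by rewrite /r bal; apply: eq_card => y; rewrite !inE.
  case: res => [cY|[q7 [m mY]]].
    by constructor 2; exists r; split=> //; apply/complete_bipartite_iso; exists c.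
  constructor 3; exists r.
  have [f fB fc] := side_bijection cr.
  have [_ []] := delete_matching_iso (complete_bipartite r r) Y.
    exists f; split=> //; first by move=> x y /cN; rewrite complete_bipartiteE !fc.
    by exists m => x y; rewrite complete_bipartiteE !fc.
  by move=> M pM iM; exists M.
- case=> [/(complete_graph_iso hY) aY|[r [qr /complete_bipartite_iso[c cr cY]]]|].
  + exact: (complete_lex_edgeless _ hq hY Yconn kY aY).
  + exact: (bipartite_lex_edgeless _ hq hY Yconn kY qr cr cY).
  case=> r [M [qr q7 pM iM]].
  have [f [fB fadj [m mY]]] :=
    (delete_matching_iso (complete_bipartite r r) Y).1 (ex_intro2 _ _ M pM iM).
  apply: (@bipartite_matching_lex_edgeless _ _ _ _ hq hY Yconn kY (fun y => side (f y)) r qr _ m q7).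
  + by move=> b; apply: bijective_side_card.
  + by move=> x y /fadj; rewrite complete_bipartiteE.
  by move=> x y; rewrite -mY complete_bipartiteE.
- move=> ram; have [aY|[m mY]] := ramanujan_lex_complete hq hY Yconn kY ram.
    by left; apply/complete_graph_iso.
  right; have [k0 kq] := lex_degree_bounds hq hY Yconn kY.
  pose r := (q - 1)./2.
  have mK : involutive m.
    by apply: (matching_involutive (R := @adj (complement Y))) => //; apply: adj_sym.
  have adjm x : @adj (complement Y) x (m x) by rewrite complement_adjE mY.
  (* A perfect matching of the complement of [Y] shows that #|Y| is even. *)
  have [M' pM' _] := @involution_perfect_matching (complement Y) m mK adjm.
  have n2 : #|Y| = 2 * #|M'| by rewrite -cardsT; apply: card_perfect_matching pM'.
  have qr : q - 1 = 2 * r by rewrite /r -hY n2 [X in X./2]mul2n doubleK.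
  (* For q = 3 there are two vertices, yet x, a neighbour y and the non-neighbour m x would be
     three. As q is odd, q >= 5 follows. *)
  have q4 : q != 3.
    apply/eqP => q3; have [x _] := lex_base_vertex hq hY.
    have [y xy] := lex_neighbour hq hY Yconn x.
    have := adjm x; rewrite complement_adjE => /andP[xm xNm].
    have : #|[set x; y; m x]| = 3.
      rewrite -setUA cardsU1 cards2 !inE negb_or xm (adj_neq xy).
      by case: eqP => // e; rewrite -e xy in xNm.
    by have := max_card [set x; y; m x]; rewrite hY q3 => + e; rewrite e.
  (* Any bijection will do, because all distinct vertices of the host are adjacent. *)
  have [|f fB] := @card_bijective Y 'I_(2 * r); first by rewrite card_ord hY.
  have [_ []] := delete_matching_iso (complete_graph (2 * r)) Y.
    exists f; split=> //; first by move=> x y /adj_neq; rewrite -(inj_eq (bij_inj fB)).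
    exists m => x y; rewrite -mY -(inj_eq (bij_inj fB)) //.
  by move=> M pM iM; exists r, M; split=> //; lia.
case=> [/(complete_graph_iso hY) aY|[r [M [qr q5 pM iM]]]].
  exact: (complete_lex_complete _ hq hY Yconn kY aY).
have [f [fB fadj [m mY]]] :=
  (delete_matching_iso (complete_graph (2 * r)) Y).1 (ex_intro2 _ _ M pM iM).
apply: (@cocktail_lex_complete _ _ _ _ hq hY Yconn kY m q5) => x y.
by rewrite -mY -(inj_eq (bij_inj fB)).
Qed.
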